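(* Let $n\ge1$ and let $\mathscr A$ be a symmetric orientation of $A_{2n-1}$. Then the convex hull of $\{M_{\mathscr A}(T):T\in\mathcal T^B_{2n+2}\}\subset\mathbb R^{2n}$ is a realization of the cyclohedron $\mathrm{Ass}(B_n)$ (a convex polytope combinatorially equivalent to the $n$-dimensional cyclohedron), and all these points have integer coordinates.
   Context: Set $m=2n$. $A_{m-1}$ is the path with vertices $\tau_1,\dots,\tau_{m-1}$ and edges $\{\tau_i,\tau_{i+1}\}$; an orientation $\mathscr A$ directs each edge. It is symmetric if for every $i\in[2n-2]$ the edges $\{\tau_i,\tau_{i+1}\}$ and $\{\tau_{2n-i-1},\tau_{2n-i}\}$ are oriented in opposite directions (i.e. $\tau_i\to\tau_{i+1}$ iff $\tau_{2n-i}\to\tau_{2n-i-1}$); these correspond bijectively to orientations of the Coxeter graph $B_n$. $i\in\{2,\dots,m-1\}$ is up if $\{\tau_{i-1},\tau_i\}$ is directed from $\tau_i$ to $\tau_{i-1}$, down otherwise; $1,m$ are down. Labelled polygon: in a convex $(m+2)$-gon $P$ label a vertex $0$, then counterclockwise the down elements increasingly, then $m+1$, then the up elements decreasingly. A triangulation $T$ is a set of $m-1$ non-crossing diagonals, viewed as a graph together with the boundary edges; $\{a,b\}\in T$ means it is an edge of this graph; $\mathcal T_{m+2}$ is the set of triangulations. $T$ is centrally symmetric if, viewing the labelled polygon as a regular $(2n+2)$-gon, $T$ is invariant under the central symmetry; $\mathcal T^B_{2n+2}$ is the set of centrally symmetric triangulations. $\mu_i(j)$ ($i\in[m]$, $0\le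 j\le m+1$) is the number of edges of the boundary path of $P$ from $i$ to $j$ using only labels $\le i$ if $j<i$, only labels $\ge i$ if $j\ge i$. $p^T_\ell(i)=\max\{\mu_i(a):0\le a<i,\{a,i\}\in T\}$, $p^T_r(i)=\max\{\mu_i(b):i<b\le m+1,\{i,b\}\in T\}$, $\omega_i=p^T_\ell(i)p^T_r(i)$, $x_i=\omega_i$ ($i$ down) or $m+1-\omega_i$ ($i$ up), $M_{\mathscr A}(T)=(x_1,\dots,x_m)$. The cyclohedron $\mathrm{Ass}(B_n)$ is (up to combinatorial equivalence) the $n$-dimensional simple polytope whose face lattice is isomorphic to the poset of centrally symmetric sets of pairwise non-crossing diagonals of a regular $(2n+2)$-gon, ordered by reverse inclusion (vertices correspond to centrally symmetric triangulations). *)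

(* Defs.v *)
From mathcomp Require Import all_boot all_order all_algebra.
From mathcomp Require Import boolp classical_sets reals convex.

Set Implicit Arguments.
Unset Strict Implicit.
Unset Printing Implicit Defensive.

Import Order.TTheory GRing.Theory Num.Theory.
Local Open Scope nat_scope.

(* Convex N-gon, meant for N >= 3: the vertices are 'I_N in counterclockwise
   order (ordS is the cyclic successor), and a segment joining two vertices is
   the 2-set of its endpoints. *)
Section Polygon.
Variable N : nat.
Implicit Types (u v : 'I_N) (d e : {set 'I_N}) (D T : {set {set 'I_N}}).

Definition boundary_edge e : bool := [exists u, e == [set u; ordS u]].

Definition diagonal d : bool := (#|d| == 2) && ~~ boundary_edge d.

(* Two diagonals of a convex polygon cross in their interiors exactly when
   their endpoints are distinct and alternate around the boundary. *)
Definition separated d e : bool :=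
  [exists a : 'I_N, exists b : 'I_N, exists c : 'I_N, exists f : 'I_N,
    [&& a < b, b < c, c < f, d == [set a; c] & e == [set b; f]]].

Definition crossing d e : bool := separated d e || separated e d.

Definition noncrossing_diagonals D : bool :=
  [forall d in D, diagonal d] && [forall d in D, forall e in D, ~~ crossing d e].

Definition triangulation T : bool :=
  noncrossing_diagonals T && (#|T| == N - 3).

Definition ccw_dist u v : nat := (v + N - u) %% N.

Definition ccw_path u v : seq 'I_N :=
  [seq iter k (@ordS N) u | k <- iota 0 (ccw_dist u v).+1].

End Polygon.

Section CentralSymmetry.
Variable n : nat.
Implicit Type D : {set {set 'I_(2 * n).+2}}.

(* Half-turn of the regular (2n+2)-gon. *)
Definition half_turn (u : 'I_(2 * n).+2) : 'I_(2 * n).+2 :=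
  iter n.+1 (@ordS (2 * n).+2) u.

Definition centrally_symmetric D : bool :=
  [set half_turn @: (d : {set 'I_(2 * n).+2}) | d in D] == D.

Definition cs_triangulation D : bool :=
  triangulation D && centrally_symmetric D.

(* Face lattice of the cyclohedron: None is the empty face, Some D the nonempty
   face indexed by D; the whole polytope is indexed by the empty set. *)
Definition cyclohedron_face : Type :=
  option {D : {set {set 'I_(2 * n).+2}}
         | noncrossing_diagonals D && centrally_symmetric D}.

Definition cyclohedron_le (x y : cyclohedron_face) : bool :=
  match x, y with
  | None, _ => true
  | Some _, None => false
  | Some D, Some E => val E \subset val D
  end.

End CentralSymmetry.

(* Orientations of the path tau_1 - ... - tau_(2n-1): for e < 2n-2, A e = true
   directs the edge {tau_(e+1), tau_(e+2)} from tau_(e+1) to tau_(e+2), and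
   A e = false directs it the other way. *)
Definition orientation (n : nat) : predArgType := {ffun 'I_(2 * n - 2) -> bool}.

Section Labelling.
Variables (n : nat) (A : orientation n).
Local Notation m := (2 * n).
Implicit Type T : {set {set 'I_m.+2}}.

(* arrow i j : the edge {tau_i, tau_j} exists and is directed tau_i -> tau_j. *)
Definition arrow (i j : nat) : bool :=
  [exists e : 'I_(2 * n - 2),
    (i, j) == (if A e then (e.+1, e.+2) else (e.+2, e.+1))].

Definition symmetric_orientation : Prop :=
  forall i, 1 <= i <= m - 2 -> arrow i i.+1 = arrow (m - i) (m - i - 1).

Definition up (i : nat) : bool := [&& 2 <= i, i <= m - 1 & arrow i i.-1].

Definition labels : seq nat :=
  0 :: [seq i <- iota 1 m | ~~ up i] ++ m.+1 :: rev [seq i <- iota 1 m | up i].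

Definition label (u : 'I_m.+2) : nat := nth 0 labels u.

(* Inverse of label on 0, ..., m+1. *)
Definition vertex (i : nat) : 'I_m.+2 := inord (index i labels).

(* {a, b} is an edge of T together with the boundary of the polygon. *)
Definition tri_edge T (a b : nat) : bool :=
  let e := [set vertex a; vertex b] in (e \in T) || boundary_edge e.

Definition mu_allowed (i j l : nat) : bool := if j < i then l <= i else i <= l.

(* Between distinct i in [1, m] and j in [0, m+1] exactly one of the two
   boundary paths uses allowed labels only: the other one passes through m+1
   (if j < i) or through 0 (if j > i). *)
Definition mu (i j : nat) : nat :=
  if all (mu_allowed i j) (map label (ccw_path (vertex i) (vertex j)))
  then ccw_dist (vertex i) (vertex j)
  else ccw_dist (vertex j) (vertex i).

Definition p_left T (i : nat) : nat :=
  \max_(0 <= a < i | tri_edge T a i) mu i a.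

Definition p_right T (i : nat) : nat :=
  \max_(i.+1 <= b < m.+2 | tri_edge T i b) mu i b.

Definition weight T (i : nat) : nat := p_left T i * p_right T i.

End Labelling.

Local Open Scope ring_scope.
Local Open Scope classical_set_scope.

(* Column k carries the coordinate x_(k+1). *)
Definition M_point (R : realType) (n : nat) (A : orientation n)
    (T : {set {set 'I_(2 * n).+2}}) : 'rV[R]_(2 * n) :=
  \row_(k < 2 * n)
    (if up A k.+1 then (2 * n).+1%:R - (weight A T k.+1)%:R
     else (weight A T k.+1)%:R).

Section Polytopes.
Variables (R : realType) (m : nat).
Local Notation V := 'rV[R]_m.
Implicit Type S : set V.

Definition convex_hull (X : set V) : set V := smallest (@convex_set R V) X.

Definition polytope S : Prop :=
  exists s : seq V, S = convex_hull [set x | x \in s].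

(* The affine hull of S is p + U with \dim U = d. *)
Definition has_dim S (d : nat) : Prop :=
  exists (p : V) (U : {vspace V}),
    [/\ S p,
        forall x, S x -> x - p \in U,
        forall W : {vspace V}, (forall x, S x -> x - p \in W) -> (U <= W)%VS
      & \dim U = d].

(* Intersections of S with the hyperplane of a valid inequality; c = 0 yields
   S itself and the empty face. *)
Definition face S (F : set V) : Prop :=
  exists (c : 'cV[R]_m) (b : R),
    (forall x, S x -> (x *m c) 0 0 <= b) /\
    F = S `&` [set x | (x *m c) 0 0 = b].

Definition face_lattice_iso S (L : Type) (le : rel L) : Prop :=
  exists phi : L -> set V,
    [/\ forall x, face S (phi x),
        forall F, face S F -> exists x, phi x = F
      & forall x y, le x y <-> phi x `<=` phi y].

Definition realizes_cyclohedron (n : nat) S : Prop :=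
  [/\ polytope S, has_dim S n & face_lattice_iso S (@cyclohedron_le n)].

End Polytopes.

(* Main.v *)
Require Import Defs.
From mathcomp Require Import all_boot all_order all_algebra.
From mathcomp Require Import zify ring lra.
Import Order.TTheory GRing.Theory Num.Theory.

(* Each triangle a < i < b of a labelled triangulation has a middle label i, and
   every i in [m] is the middle of exactly one triangle; omega_i is the product
   of the boundary lengths cut off by its sides ai and ib.  A flip changes only
   the coordinates of the middles i, j of the triangles below and above the
   flipped diagonal, and it adds t (e_i - e_j) for some t > 0.

   For a diagonal d let f_d be the sum of the coordinates whose labels lie below
   d.  If no flip decreases f_d at T, then the triangles with middle below d
   form a lower set, which forces d into T.  On the other hand all T through d
   are connected, by flips leaving f_d unchanged, to the fan at an endpoint of
   d.  So f_d is minimal exactly at the triangulations containing d.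

   For centrally symmetric T, x_i + x_(2n+1-i) = 2n+1, so the points lie in an
   affine space of dimension n.  T has n orbits of diagonals, flipping an orbit
   moves M(T) off one facet only, and so the n flip directions are a basis dual
   (up to positive scalars) to the functionals f_d + f_(turn d).  Hence the
   polytope lies in the cone that they span at M(T), and the face maximizing a
   functional is cut out by the orbits whose flip decreases it. *)

Set Implicit Arguments.
Unset Strict Implicit.
Unset Printing Implicit Defensive.
Local Open Scope nat_scope.

(** * Maximal noncrossing graphs on the vertices of a polygon *)

(** All that is used of the labelled polygon is that a triple of vertices with increasing labels is
    counterclockwise exactly when its middle is down. One may picture the labels as abscissae, with
    the down vertices on a lower chain and the up vertices on an upper one. Every case analysis then
    becomes linear arithmetic on positions and labels, for all orientations at once. The minimal
    value of [f_d] is never computed. It is enough that the minimum is attained, that a minimizer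
    contains [d], and that all triangulations through [d] share one value; the fan is the common
    reference because its centre determines it. A fan is in general not centrally symmetric, so the
    facet inequalities are proved for all triangulations, and symmetry enters only afterwards, by
    adding the inequalities of [d] and [turn d]. The dimension is bounded from both sides: the
    relations between opposite coordinates leave at most [n], and the independent flip directions at
    one vertex give at least [n]. *)

Definition cyc (u v w : nat) : bool := [|| u < v < w, v < w < u | w < u < v].

(* Clearing first matters: zify case-splits on every boolean hypothesis. *)
Ltac cyc_lia :=
  repeat match goal with
  | H : ?T |- _ =>
    match type of T with Prop =>
      lazymatch T with
      | context [cyc] => fail
      | context [leq] => fail
      | context [@eq_op] => fail
      | context [addn] => fail
      | _ => clear H
      end
    end
  end; unfold cyc in *; lia.

Lemma cyc_rot u v w : cyc u v w = cyc v w u.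
Proof. cyc_lia. Qed.

Section Triangulations.
Variable N : nat.
Implicit Types (u v w x y z : 'I_N) (E : rel 'I_N).

Local Notation cd := (@ccw_dist N).

(** Trades the remainder in [ccw_dist] for two linear cases that [lia] can use. *)
Lemma cdP u v : cd u v + u = v \/ v < u /\ cd u v + u = v + N.
Proof.
rewrite /ccw_dist; have := ltn_ord u; have := ltn_ord v => ? ?.
case: (leqP u v) => uv; [left|right].
  have -> : v + N - u = (v - u) + N by lia.
  by rewrite modnDr modn_small; lia.
by rewrite modn_small; lia.
Qed.

Lemma cd_lt u v : cd u v < N.
Proof. by rewrite ltn_mod; have := ltn_ord u; lia. Qed.

Lemma cdD u v w : cyc u v w -> cd u w = cd u v + cd v w.
Proof.
have := cdP u w; have := cdP u v; have := cdP v w.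
have := cd_lt u w; have := cd_lt u v; have := cd_lt v w; cyc_lia.
Qed.

Lemma cdC u v : (u != v :> nat) -> cd u v + cd v u = N.
Proof.
have := cdP u v; have := cdP v u; have := cd_lt u v; have := cd_lt v u; lia.
Qed.

Lemma cd_gt0 u v : (u != v :> nat) -> 0 < cd u v.
Proof. have := cdP u v; have := ltn_ord u; lia. Qed.

Lemma cd_ltP u v w :
  u != v :> nat -> u != w :> nat -> cyc u v w = (cd u v < cd u w).
Proof.
move=> uv uw; have := cdP u v; have := cdP u w.
have := cd_lt u v; have := cd_lt u w; have := ltn_ord v; have := ltn_ord w.
by case: ltnP; cyc_lia.
Qed.

Lemma val_ordS u : ordS u = (if u.+1 == N then 0 else u.+1) :> nat.
Proof.
rewrite /=; case: eqP => [->|]; first by rewrite modnn.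
by move=> ne; rewrite modn_small //; have := ltn_ord u; lia.
Qed.

Lemma cyc_ordS u x v : cyc u x v -> cyc u (ordS u) v.
Proof.
have := ltn_ord u; have := ltn_ord v; have := ltn_ord x.
by move=> ? ? ?; rewrite val_ordS; case: eqP; cyc_lia.
Qed.

Lemma ordS_adjacent u x : cyc u x (ordS u) = false.
Proof.
by have := ltn_ord u; have := ltn_ord x => ? ?; rewrite val_ordS; case: eqP; cyc_lia.
Qed.

(** Boundary edges belong to such a graph by maximality, since nothing crosses them. Crossings are
    tested for one direction of [xy] only; symmetry supplies the other. *)
Record maximal_noncrossing E : Prop := MaximalNoncrossing {
  mnc_sym : symmetric E;
  mnc_irr : irreflexive E;
  mnc_noncrossing : forall u v x y,
    E u v -> E x y -> cyc u x v -> cyc v y u -> False;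
  mnc_max : forall u v, u != v ->
    (forall x y, E x y -> cyc u x v -> cyc v y u -> False) -> E u v }.

Section Graph.
Variables (E : rel 'I_N) (mE : maximal_noncrossing E).
Let symE := mnc_sym mE.
Let noncrossing := mnc_noncrossing mE.

Lemma mnc_neq u v : E u v -> (u != v :> nat).
Proof. by apply: contraTneq => /val_inj->; rewrite (mnc_irr mE). Qed.

Lemma mnc_ordS u x v : cyc u x v -> E u (ordS u).
Proof.
move=> c; apply: (mnc_max mE) => [|x' y' _]; last by rewrite ordS_adjacent.
by apply/eqP=> uS; move: (cyc_ordS c); rewrite -uS; cyc_lia.
Qed.

(** The third vertex is the neighbour of [u] on this arc farthest from [u]. An edge crossing [zv]
    would end at [u], against the choice of [z], or cross [uv] or [uz]. *)
Lemma side_triangle u x v :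
  E u v -> cyc u x v -> exists z, [/\ cyc u z v, E u z & E z v].
Proof.
move=> uv c; pose P z := E u z && cyc u z v.
have P0 : P (ordS u) by rewrite /P (mnc_ordS c) (cyc_ordS c).
case: (arg_maxnP (fun z => cd u z) P0) => z /andP[uz cz] zmax.
exists z; split => //; apply: (mnc_max mE) => [|s t st cs ct].
  by apply/eqP=> zv; move: cz; rewrite zv; cyc_lia.
have : [|| t == u :> nat, cyc v t u | cyc u t z] by cyc_lia.
case/or3P => [/eqP/val_inj tu|ct'|ct'].
- subst t; have cus : cyc u s v by cyc_lia.
  have := zmax s; rewrite /P symE st cus => /(_ isT).
  by apply/negP; rewrite -ltnNge -cd_ltP; cyc_lia.
- by apply: (noncrossing uv st) => //; cyc_lia.
- rewrite symE in st.
  by apply: (noncrossing uz st) => //; cyc_lia.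
Qed.

Lemma side_triangle_uniq u v z z' :
  cyc u z v -> E u z -> E z v -> cyc u z' v -> E u z' -> E z' v -> z = z'.
Proof.
move=> c uz zv c' uz' zv'; apply/val_inj/eqP.
have /or3P[//|k|k] : [|| z == z' :> nat, cyc u z z' | cyc u z' z] by cyc_lia.
- by case: (noncrossing uz' zv) => //; cyc_lia.
- by case: (noncrossing uz zv') => //; cyc_lia.
Qed.

(** Among the edges crossing [ab], take one that cuts off the shortest arc around [a]. If the
    triangle on its [a]-side had a third vertex other than [a], one of its other sides would cross
    [ab] and cut off a shorter arc. *)
Lemma first_crossing a b : a != b -> ~~ E a b ->
  exists x y, [/\ cyc a x b, cyc b y a, E x y, E a x & E y a].
Proof.
move=> nab nE.
pose P (p : 'I_N * 'I_N) := [&& E p.1 p.2, cyc a p.1 b & cyc b p.2 a].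
have [p0 P0|noP] := pickP P; last first.
  case/negP: nE; apply: (mnc_max mE) => // x y exy cx cy.
  by have := noP (x, y); rewrite /P /= exy cx cy.
case: (arg_minnP (fun p : 'I_N * 'I_N => cd p.2 p.1) P0).
move=> -[x y] /= /and3P[exy cx cy] pmin; rewrite /= in exy cx cy.
have eyx : E y x by rewrite symE.
have cyax : cyc y a x by clear -cx cy; cyc_lia.
have [w [cw eyw ewx]] := side_triangle eyx cyax.
have cdw := cdD cw.
have nyw : y != w :> nat by clear -cw; cyc_lia.
have nwx : w != x :> nat by clear -cw; cyc_lia.
have gyw := cd_gt0 nyw; have gwx := cd_gt0 nwx.
have /or3P[/eqP/val_inj wa|cwx|cwy] :
    [|| w == a :> nat, cyc a w x | cyc y w a] by clear -cx cy cw; cyc_lia.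
- by subst w; exists x, y.
- have := pmin (w, y); rewrite /P /= symE eyw cy andbT => H1.
  have : cyc a w b by clear -cwx cx; cyc_lia.
  by move=> /H1; clear -cdw gwx; lia.
- have := pmin (x, w); rewrite /P /= symE ewx cx => H1.
  have : cyc b w a by clear -cwy cy; cyc_lia.
  by move=> /H1; clear -cdw gyw; lia.
Qed.

End Graph.
End Triangulations.

(** * Labelled polygons and flips *)

Section LabelledTriangulations.
Variables (N : nat) (lam : 'I_N -> nat) (dn : pred 'I_N).
Implicit Types (a b k u v w x y z : 'I_N) (E : rel 'I_N).
Local Notation cd := (@ccw_dist N).

Ltac lam_lia :=
  repeat match goal with
  | H : ?T |- _ =>
    match type of T with Prop =>
      lazymatch T with
      | forall _, _ => clear H
      | context [lam] => fail
      | context [dn] => fail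
      | _ => clear H
      end
    end
  end; lia.

Record labelling : Prop := Labelling {
  lab_inj : injective lam;
  lab_cyc : forall u v w, lam u < lam v -> lam v < lam w -> cyc u v w = dn v }.

Hypothesis lab : labelling.

Lemma lab_neq u v : (u != v :> nat) = (lam u != lam v).
Proof.
have -> : (u == v :> nat) = (u == v) by [].
by congr (~~ _); apply/eqP/eqP => [->//|]; exact: (lab_inj lab).
Qed.

(** The arc counterclockwise from [u] to [v] is the part below the chord [uv]. A vertex there with a
    label beyond an endpoint forces that endpoint to be up. *)
Lemma side_label u v z : lam u < lam v -> cyc u z v ->
  [|| (lam z < lam u) && ~~ dn u, [&& lam u < lam z, lam z < lam v & dn z]
    | (lam v < lam z) && ~~ dn v].
Proof.
move=> uv c.
have zu : lam z != lam u by rewrite -lab_neq; cyc_lia.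
have zv : lam z != lam v by rewrite -lab_neq; cyc_lia.
case: (ltngtP (lam z) (lam u)) zu => // zu _.
  by have := lab_cyc lab zu uv => <-; cyc_lia.
case: (ltngtP (lam z) (lam v)) zv => // zv _.
  by have := lab_cyc lab zu zv => <-; cyc_lia.
by have := lab_cyc lab uv zv => <-; cyc_lia.
Qed.

Lemma side_label' u v y : lam u < lam v -> cyc v y u ->
  [|| (lam y < lam u) && dn u, [&& lam u < lam y, lam y < lam v & ~~ dn y]
    | (lam v < lam y) && dn v].
Proof.
move=> uv c.
have yu : lam y != lam u by rewrite -lab_neq; cyc_lia.
have yv : lam y != lam v by rewrite -lab_neq; cyc_lia.
case: (ltngtP (lam y) (lam u)) yu => // yu _.
  by have := lab_cyc lab yu uv => <-; cyc_lia.
case: (ltngtP (lam y) (lam v)) yv => // yv _.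
  by have := lab_cyc lab yu yv => <-; cyc_lia.
by have := lab_cyc lab uv yv => <-; cyc_lia.
Qed.

(** [P] holds on an initial arc counterclockwise from [v]. The last neighbour [b] of [v] in this arc
    spans, on its far side, a triangle with [v] whose third vertex is outside the arc. *)
Lemma split_triangle E (P : pred 'I_N) v b0 a0 :
    maximal_noncrossing E -> P b0 -> ~~ P a0 -> a0 != v :> nat ->
    (forall x y, P x -> ~~ P y -> y != v :> nat -> cyc v x y) ->
  exists a b, [/\ P b, ~~ P a, E v b, E a v & E a b].
Proof.
move=> mE Pb0 Pa0 a0v sep; have symE := mnc_sym mE.
have cS : cyc v b0 a0 by apply: sep.
have P0 : P (ordS v) && E v (ordS v).
  rewrite (mnc_ordS mE cS) andbT; apply/negPn/negP => nP.
  have /(sep _ _ Pb0 nP) : ordS v != v :> nat.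
    by have := cyc_ordS cS; cyc_lia.
  by rewrite ordS_adjacent.
case: (arg_maxnP (P := fun b => P b && E v b) (fun b => cd v b) P0).
move=> b /andP[Pb vb] bmax.
have c := sep _ _ Pb Pa0 a0v.
have bv : E b v by rewrite symE.
have [|z [cz bz zv]] := side_triangle mE bv (x := a0); first by cyc_lia.
exists z, b; split=> //; last by rewrite symE.
apply/negP=> Pz; have := bmax z; rewrite Pz symE zv => /(_ isT).
by apply/negP; rewrite -ltnNge -cd_ltP; cyc_lia.
Qed.

Lemma mid_triangle E a0 v b0 :
    maximal_noncrossing E -> lam a0 < lam v -> lam v < lam b0 ->
  exists a b, [/\ lam a < lam v, lam v < lam b, E a v, E v b & E a b].
Proof.
move=> mE av vb; have symE := mnc_sym mE.
have nlt x : x != v :> nat -> (lam x < lam v) = ~~ (lam v < lam x).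
  by rewrite lab_neq; lia.
have neq x : lam x < lam v -> x != v :> nat by rewrite lab_neq; lia.
(* Counterclockwise from a down vertex come first the larger labels, then the smaller ones; from an
   up vertex it is the other way round. *)
case dnv: (dn v).
- have [||||a [b [vb' av' e1 e2 e3]]] :=
    @split_triangle E (fun x => lam v < lam x) v b0 a0 mE => //.
  + by rewrite -nlt ?neq.
  + exact: neq.
  + move=> x y vx; rewrite -[~~ _]/(~~ (lam v < lam y)) => vy yv.
    by rewrite -cyc_rot (lab_cyc lab) // nlt.
  + exists a, b; split=> //; rewrite nlt //; exact: (mnc_neq mE e2).
- have [||||b [a [av' vb' e1 e2 e3]]] :=
    @split_triangle E (fun x => lam x < lam v) v a0 b0 mE => //.
  + by rewrite -leqNgt ltnW.
  + by rewrite lab_neq; lia.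
  + move=> x y xv vy yv.
    have xy : lam v < lam y by move: yv vy; rewrite lab_neq /=; lia.
    have := lab_cyc lab xv xy; rewrite dnv.
    have : (x != y :> nat) by rewrite lab_neq; lia.
    by have := neq _ xv; cyc_lia.
  + exists a, b; split=> //; try by rewrite symE.
    by move: (mnc_neq mE e2) vb'; rewrite lab_neq /=; lia.
Qed.

(** The two arcs lie away from the triangle: [a], [v], [b] are counterclockwise if [v] is down and
    clockwise if it is up. *)
Definition tri_weight a v b : nat :=
  if dn v then cd a v * cd v b else cd v a * cd b v.

(** Separates the study of flips from the maxima that define [weight]. *)
Definition mid_weight E (W : 'I_N -> nat) : Prop :=
  forall a v b, lam a < lam v -> lam v < lam b -> E a v -> E v b -> E a b ->
    W v = tri_weight a v b.

(** [N - 1] is [m + 1], as the polygon has [m + 2] vertices. *)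
Definition tri_coord (W : 'I_N -> nat) v : int :=
  (if dn v then (W v)%:Z else N%:Z - 1 - (W v)%:Z)%R.

Definition mid u v z : 'I_N :=
  if lam z < lam u then u else if lam v < lam z then v else z.

Lemma mid_eq u v r i : lam u < lam v ->
  [|| (i == u) && (lam r < lam u), (i == v) && (lam v < lam r) |
      [&& i == r, lam u < lam r & lam r < lam v]] -> mid u v r = i.
Proof.
move=> uv; rewrite /mid => /or3P[/andP[/eqP-> ->]//|/andP[/eqP-> vr]|].
  by rewrite vr ltnNge (ltnW (ltn_trans uv vr)).
by case/and3P => /eqP -> ur rv; rewrite !ltnNge (ltnW ur) (ltnW rv).
Qed.

(* The flip of uv to zy adds to the middle of the triangle below uv, and takes
   from the middle of the triangle above it, the product of the lengths of the
   two opposite sides of the quadrilateral that separate its two smallest from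
   its two largest labels. *)
Ltac fin_case fin solve_mid i p1 r1 j p2 r2 p3 r3 p4 r4 ee es :=
  apply: (fin i j p1 r1 p2 r2 p3 r3 p4 r4);
  [by apply: solve_mid; rewrite eqxx; lam_lia
  |by apply: solve_mid; rewrite eqxx; lam_lia
  |lam_lia|lam_lia|lam_lia|lam_lia
  |by rewrite ?ee ?es|by rewrite ?ee ?es|by rewrite ?ee ?es|by rewrite ?ee ?es|
  rewrite /tri_weight /=].

Ltac fin_alg := first [left; split; ring | right; split; ring].

Lemma flip_coord E E' W W' u v z y :
    maximal_noncrossing E -> symmetric E' ->
    mid_weight E W -> mid_weight E' W' ->
    lam u < lam v -> cyc u z v -> cyc v y u ->
    E u v -> E u z -> E z v -> E v y -> E y u -> E' z y ->
    (forall p q, E p q -> E' p q \/ [set p; q] = [set u; v]) ->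
  exists t : int, [/\ (0 < t)%R,
    tri_coord W' (mid u v z) = (tri_coord W (mid u v z) + t)%R,
    tri_coord W' (mid u v y) = (tri_coord W (mid u v y) - t)%R &
    forall a k b, lam a < lam k -> lam k < lam b ->
      k != mid u v z -> k != mid u v y -> W' k = W k].
Proof.
move=> mE symE' wW wW' uv cz cy euv euz ezv evy eyu ezy' sub.
have symE := mnc_sym mE.
have keep p q : E p q -> (q != u) && (q != v) -> E' p q.
  move=> /sub[//|/setP/(_ q)]; rewrite !inE eqxx orbT => /esym/orP[]/eqP->.
    by rewrite eqxx.
  by rewrite eqxx andbF.
have zu : z != u by rewrite -val_eqE /=; cyc_lia.
have zv : z != v by rewrite -val_eqE /=; cyc_lia.
have yu : y != u by rewrite -val_eqE /=; cyc_lia.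
have yv : y != v by rewrite -val_eqE /=; cyc_lia.
have euz' : E' u z by rewrite keep // zu zv.
have ezv' : E' z v by rewrite symE' keep ?zu ?zv // symE.
have evy' : E' v y by rewrite keep // yu yv.
have eyu' : E' y u by rewrite symE' keep ?yu ?yv // symE.
have ee := (euv, euz, ezv, evy, eyu, euz', ezv', evy', eyu', ezy').
have es : ((E v u * E z u * E v z * E y v * E u y) *
          (E' z u * E' v z * E' y v * E' u y * E' y z))%type.
  by do !split; rewrite ?(symE v u) ?(symE z u) ?(symE v z) ?(symE y v)
     ?(symE u y) ?(symE' z u) ?(symE' v z) ?(symE' y v) ?(symE' u y)
     ?(symE' y z) ?ee.
have XE p q r : lam p < lam q -> lam q < lam r -> E p q && E q r && E p r ->
    W q = tri_weight p q r.
  by move=> ? ? /andP[/andP[? ?] ?]; apply: wW.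
have XE' p q r : lam p < lam q -> lam q < lam r ->
    E' p q && E' q r && E' p r -> W' q = tri_weight p q r.
  by move=> ? ? /andP[/andP[? ?] ?]; apply: wW'.
(* The other middles keep their triangles: the only edge that can be lost is [uv], and only the
   triangles [uzv] and [uvy] have it as a side. *)
have rest a k b : lam a < lam k -> lam k < lam b ->
      k != mid u v z -> k != mid u v y -> W' k = W k.
  move=> ak kb nz ny.
  have [a' [b' [ak' kb' e1 e2 e3]]] := mid_triangle mE ak kb.
  have ab' := ltn_trans ak' kb'.
  rewrite (wW _ _ _ ak' kb' e1 e2 e3).
  have case3 p q r : [set p; q] = [set u; v] -> E q r -> E p r ->
      r = z \/ r = y.
    move=> pq qr pr; have npq : (p != q :> nat).
      apply/eqP=> /val_inj pq'; move: uv; rewrite ltnNge; case/negP.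
      have := set21 u v; rewrite -pq pq' setUid inE => /eqP->.
      by have := set22 u v; rewrite -pq pq' setUid inE => /eqP->.
    have nr := mnc_neq mE qr; have nr' := mnc_neq mE pr.
    have [ur vr] : E u r /\ E v r.
      by split; [have := set21 u v|have := set22 u v];
         rewrite -pq !inE => /orP[]/eqP->.
    have ru := mnc_neq mE ur; have rv := mnc_neq mE vr.
    have rv' : E r v by rewrite symE.
    have ru' : E r u by rewrite symE.
    have uv' : (u != v :> nat) by rewrite lab_neq; lam_lia.
    case cr: (cyc u r v); [left|right].
      exact: (side_triangle_uniq mE cr ur rv' cz euz ezv).
    have cr' : cyc v r u by cyc_lia.
    exact: (side_triangle_uniq mE cr' vr ru' cy evy eyu).
  have kmid p q r : [set p; q] = [set u; v] -> lam p < lam q ->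
     [|| (k == p) && (lam r < lam p), (k == q) && (lam q < lam r) |
         [&& k == r, lam p < lam r & lam r < lam q]] -> k = mid u v r.
    move=> pq lpq; have [pu qv] : p = u /\ q = v.
      have /esym := set21 p q; rewrite pq !inE => /esym/orP[]/eqP pE;
      have /esym := set22 p q; rewrite pq !inE => /esym/orP[]/eqP qE;
      move: lpq; rewrite pE qE ?ltnn //; lam_lia.
    by rewrite pu qv => /(mid_eq uv)->.
  have bad p q r : [set p; q] = [set u; v] -> lam p < lam q -> E q r -> E p r ->
    [|| (k == p) && (lam r < lam p), (k == q) && (lam q < lam r) |
         [&& k == r, lam p < lam r & lam r < lam q]] -> False.
    move=> pq lpq qr pr /(kmid _ _ _ pq lpq) kE.
    by case: (case3 _ _ _ pq qr pr) => rE; move: kE; rewrite rE => kE;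
       rewrite kE eqxx in nz ny.
  apply: wW' => //.
  - case: (sub _ _ e1) => // /bad bd; case: (bd b') => //.
    by rewrite eqxx kb' /= orbT.
  - case: (sub _ _ e2) => // /bad bd; case: (bd a') => //.
      + by rewrite symE.
      + by rewrite symE.
      + by rewrite eqxx ak'.
  - case: (sub _ _ e3) => // /bad bd; case: (bd k) => //.
      + by rewrite symE.
      + by rewrite eqxx ak' kb' /= !orbT.
have sz := side_label uv cz; have sy := side_label' uv cy.
have zy : (lam z != lam y) by rewrite -lab_neq; clear -cz cy; cyc_lia.
have fin (i j : 'I_N) : mid u v z = i -> mid u v y = j ->
    (tri_coord W' i = tri_coord W i + (cd u z * cd v y)%N%:Z /\
     tri_coord W' j = tri_coord W j - (cd u z * cd v y)%N%:Z \/
     tri_coord W' i = tri_coord W i + (cd z v * cd y u)%N%:Z /\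
     tri_coord W' j = tri_coord W j - (cd z v * cd y u)%N%:Z)%R ->
  exists t : int, [/\ (0 < t)%R,
    tri_coord W' (mid u v z) = (tri_coord W (mid u v z) + t)%R,
    tri_coord W' (mid u v y) = (tri_coord W (mid u v y) - t)%R &
    forall a k b, lam a < lam k -> lam k < lam b ->
      k != mid u v z -> k != mid u v y -> W' k = W k].
  move=> iE jE; rewrite -iE -jE.
  case=> [][-> ->]; [exists (Posz (cd u z * cd v y))|exists (Posz (cd z v * cd y u))].
    split=> //; have := @cd_gt0 N u z; have := @cd_gt0 N v y.
    by move=> h1 h2; rewrite ltz_nat muln_gt0 h2 ?h1 //; cyc_lia.
  split=> //; have := @cd_gt0 N z v; have := @cd_gt0 N y u.
  by move=> h1 h2; rewrite ltz_nat muln_gt0 h2 ?h1 //; cyc_lia.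
(* All distances are expressed by the four arcs that the quadrilateral cuts off, whose sum is [N];
   each case below is then a polynomial identity. *)
have := cdD cz; have := cdD cy.
have : cyc z v y by cyc_lia.
have : cyc y u z by cyc_lia.
move=> /cdD d1 /cdD d2 d3 d4.
have zu' : z != u :> nat by clear -cz; cyc_lia.
have d5 : cd v z = cd v y + cd y u + cd u z.
  have : cyc v u z by clear -cz; cyc_lia.
  by move=> /cdD ->; rewrite d3.
have d6 : cd z u = cd z v + cd v y + cd y u.
  have : cyc z v u by clear -cz; cyc_lia.
  by move=> /cdD ->; rewrite d3 addnA.
have d7 : cd y v = cd y u + cd u z + cd z v.
  have : cyc y u v by clear -cy; cyc_lia.
  by move=> /cdD ->; rewrite d4 addnA.
have d8 : cd u y = cd u z + cd z v + cd v y.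
  have : cyc u v y by clear -cy; cyc_lia.
  by move=> /cdD ->; rewrite d4.
have NE : (N%:Z = (cd u z)%:Z + (cd z v)%:Z + (cd v y)%:Z + (cd y u)%:Z)%R.
  have := cdC zu'; rewrite d6; clear; lia.
have {}fin (i j : 'I_N) (p1 r1 p2 r2 p3 r3 p4 r4 : 'I_N) :
    mid u v z = i -> mid u v y = j ->
    lam p1 < lam i < lam r1 -> lam p2 < lam j < lam r2 ->
    lam p3 < lam i < lam r3 -> lam p4 < lam j < lam r4 ->
    E p1 i && E i r1 && E p1 r1 -> E p2 j && E j r2 && E p2 r2 ->
    E' p3 i && E' i r3 && E' p3 r3 -> E' p4 j && E' j r4 && E' p4 r4 ->
   let c k W := (if dn k then W%:Z else N%:Z - 1 - W%:Z)%R in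
   ((c i (tri_weight p3 i r3) = c i (tri_weight p1 i r1) + (cd u z * cd v y)%N%:Z /\
     c j (tri_weight p4 j r4) = c j (tri_weight p2 j r2) - (cd u z * cd v y)%N%:Z) \/
    (c i (tri_weight p3 i r3) = c i (tri_weight p1 i r1) + (cd z v * cd y u)%N%:Z /\
     c j (tri_weight p4 j r4) = c j (tri_weight p2 j r2) - (cd z v * cd y u)%N%:Z))%R ->
  exists t : int, [/\ (0 < t)%R,
    tri_coord W' (mid u v z) = (tri_coord W (mid u v z) + t)%R,
    tri_coord W' (mid u v y) = (tri_coord W (mid u v y) - t)%R &
    forall a k b, lam a < lam k -> lam k < lam b ->
      k != mid u v z -> k != mid u v y -> W' k = W k].
  move=> iE jE /andP[l1 l1'] /andP[l2 l2'] /andP[l3 l3'] /andP[l4 l4'] t1 t2 t3 t4.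
  move=> /= H; apply: (fin i j) => //; rewrite /tri_coord.
  by rewrite (XE p1 i r1) // (XE p2 j r2) // (XE' p3 i r3) // (XE' p4 j r4).
have solve_mid r i := @mid_eq u v r i uv.
(* Nine positions of [z] and [y] relative to the labels of [u] and [v]. Two are impossible, as an
   endpoint would be both up and down. If both labels lie in between, their order decides which new
   triangle has which middle. *)
case/or3P: sz => [/andP[zlu /negbTE dnu]|/and3P[uz zlv dnz]|/andP[vz /negbTE dnv]];
case/or3P: sy => [/andP[ylu dnu']|/and3P[uy ylv /negbTE dny]|/andP[vy dnv']].
- by rewrite dnu in dnu'.
- fin_case fin solve_mid u z v y u v z y z v ee es.
  rewrite dnu dny; rewrite ?(d1, d2, d3, d4, d5, d6, d7, d8) ?NE !PoszM !PoszD; fin_alg.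
- fin_case fin solve_mid u z v v u y z y z y ee es.
  rewrite dnu dnv'; rewrite ?(d1, d2, d3, d4, d5, d6, d7, d8) ?NE !PoszM !PoszD; fin_alg.
- fin_case fin solve_mid z u v u y v y v y z ee es.
  rewrite dnz dnu'; rewrite ?(d1, d2, d3, d4, d5, d6, d7, d8) ?NE !PoszM !PoszD; fin_alg.
- case: (ltngtP (lam z) (lam y)) zy => // zy _.
  + fin_case fin solve_mid z u v y u v u y z v ee es.
    rewrite dnz dny; rewrite ?(d1, d2, d3, d4, d5, d6, d7, d8) ?NE !PoszM !PoszD; fin_alg.
  + fin_case fin solve_mid z u v y u v y v u z ee es.
    rewrite dnz dny; rewrite ?(d1, d2, d3, d4, d5, d6, d7, d8) ?NE !PoszM !PoszD; fin_alg.
- fin_case fin solve_mid z u v v u y u y z y ee es.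
  rewrite dnz dnv'; rewrite ?(d1, d2, d3, d4, d5, d6, d7, d8) ?NE !PoszM !PoszD; fin_alg.
- fin_case fin solve_mid v u z u y v y z y z ee es.
  rewrite dnv dnu'; rewrite ?(d1, d2, d3, d4, d5, d6, d7, d8) ?NE !PoszM !PoszD; fin_alg.
- fin_case fin solve_mid v u z y u v y z u z ee es.
  rewrite dnv dny; rewrite ?(d1, d2, d3, d4, d5, d6, d7, d8) ?NE !PoszM !PoszD; fin_alg.
- by rewrite dnv in dnv'.
Qed.

End LabelledTriangulations.

(** * The facet attached to a diagonal *)

Section LowerSet.
Variables (N : nat) (lam : 'I_N -> nat) (dn : pred 'I_N).
Implicit Types (k u v w x y z : 'I_N) (E : rel 'I_N).
Local Notation cd := (@ccw_dist N).
Hypothesis lab : labelling lam dn.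
Variables a b : 'I_N.
Hypothesis lab_ab : lam a < lam b.

(* Vertices below ab when ab is extended horizontally on both sides: this moves
   the up endpoints, and no others, below the line. *)
Definition lower k : bool :=
  [|| cyc a k b, (k == a) && ~~ dn a | (k == b) && ~~ dn b].

Lemma lower_in k : cyc a k b -> lower k.
Proof. by rewrite /lower => ->. Qed.

Lemma lower_out k : cyc b k a -> lower k = false.
Proof.
move=> c; rewrite /lower -!val_eqE /=; apply/negbTE; rewrite !negb_or.
by apply/and3P; split; [|rewrite negb_and; apply/orP; left..]; cyc_lia.
Qed.

Lemma lower_left : lower a = ~~ dn a.
Proof.
rewrite /lower eqxx /= -val_eqE /=.
have -> : (a == b :> nat) = false by apply/negbTE; rewrite (lab_neq lab); lia.
by rewrite orbF; have -> : cyc a a b = false by cyc_lia.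
Qed.

Lemma lower_right : lower b = ~~ dn b.
Proof.
rewrite /lower eqxx /= -val_eqE /=.
have -> : (b == a :> nat) = false by apply/negbTE; rewrite (lab_neq lab); lia.
by have -> : cyc a b b = false by cyc_lia.
Qed.

(** A flip of [uv] moves a positive amount from the middle of [uvy], above [uv], to the middle of
    [uzv], below it. So this says that no flip decreases the sum over the lower vertices. *)
Definition lower_closed E : Prop := forall u v z y, lam u < lam v ->
  cyc u z v -> cyc v y u -> E u v -> E u z -> E z v -> E v y -> E y u ->
  lower (mid lam u v y) -> lower (mid lam u v z).

Ltac lab_lia :=
  repeat match goal with
  | H : ?T |- _ =>
    match type of T with Prop =>
      lazymatch T with
      | forall _, _ => clear H
      | context [cyc] => clear H
      | context [lam] => fail
      | context [dn] => fail
      | context [lower] => fail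
      | _ => clear H
      end
    end
  end; lia.

Lemma lower_mid u v z : lower (mid lam u v z) =
  if lam z < lam u then lower u else if lam v < lam z then lower v else lower z.
Proof. by rewrite /mid; case: ltnP => // _; case: ltnP. Qed.

(* Walk from a to b through the triangles crossed by ab.  If x < y and the
   triangle on the a-side of the crossing edge xy has its middle below ab, then
   so has the triangle on the b-side, and its next crossing edge is of the same
   kind; but the walk cannot end at b.  The next lemma is the reflected case. *)
Lemma strip_walk_down E x y w :
    maximal_noncrossing E -> lower_closed E ->
    cyc a x b -> cyc b y a -> lam x < lam y -> cyc y w x ->
    E x y -> E y w -> E w x -> lower (mid lam x y w) -> False.
Proof.
move=> mE H; have [m] := ubnP (cd x y); elim: m x y w => // m IH x y w.
move=> lem cx cy xy cw exy eyw ewx Kw; have symE := mnc_sym mE.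
have cxby : cyc x b y by clear -cx cy; cyc_lia.
have [z [cz exz ezy]] := side_triangle mE exy cxby.
have := H x y z w xy cz cw exy exz ezy eyw ewx Kw.
have Lx := lower_in cx; have Ly := lower_out cy.
have sx := side_label lab lab_ab cx; have sy := side_label' lab lab_ab cy.
have sz := side_label lab xy cz.
have eyx : E y x by rewrite symE.
have czx : cyc y x z by clear -cz; cyc_lia.
(* If [z] were [b] or lay above [ab], the middle of [xzy] would not be lower. So [z] lies below
   [ab], and the walk goes on across [zy], with a shorter arc around [b]. *)
have : [|| z == b :> nat, cyc x z b | cyc b z y] by clear -cx cy cz; cyc_lia.
case/or3P => [/eqP/val_inj zb|czb|czb]; rewrite lower_mid.
- subst z; have Lb := lower_right.
  by case: ltnP => ?; [|case: ltnP => ?]; lab_lia.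
- have cz' : cyc a z b by clear -czb cx; cyc_lia.
  have Lz := lower_in cz'.
  have sz' := side_label lab lab_ab cz'.
  move=> Kz; have zy : lam z < lam y.
    by move: Kz; case: ltnP => ?; [|case: ltnP => ?]; lab_lia.
  apply: (IH z y x) => //.
    have nxz : x != z :> nat by clear -cz; cyc_lia.
    by have := cdD cz; have := cd_gt0 nxz; clear -lem; lia.
  rewrite lower_mid; have -> : (lam y < lam x) = false by lab_lia.
  by case: ltnP.
- have cz' : cyc b z a by clear -czb cy; cyc_lia.
  have Lz := lower_out cz'.
  have sz' := side_label' lab lab_ab cz'.
  by case: ltnP => ?; [|case: ltnP => ?]; lab_lia.
Qed.

Lemma strip_walk_up E x y w :
    maximal_noncrossing E -> lower_closed E ->
    cyc a x b -> cyc b y a -> lam y < lam x -> cyc y w x ->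
    E x y -> E y w -> E w x -> ~~ lower (mid lam y x w) -> False.
Proof.
move=> mE H; have [m] := ubnP (cd x y); elim: m x y w => // m IH x y w.
move=> lem cx cy xy cw exy eyw ewx Kw; have symE := mnc_sym mE.
have cxby : cyc x b y by clear -cx cy; cyc_lia.
have [z [cz exz ezy]] := side_triangle mE exy cxby.
have eyx : E y x by rewrite symE.
(* Here [w] is on the lower side of [yx], so closedness is used in contrapositive form. *)
have : ~~ lower (mid lam y x z).
  by apply: contra Kw; apply: H.
have Lx := lower_in cx; have Ly := lower_out cy.
have sx := side_label lab lab_ab cx; have sy := side_label' lab lab_ab cy.
have sz := side_label' lab xy cz.
have : [|| z == b :> nat, cyc x z b | cyc b z y] by clear -cx cy cz; cyc_lia.
case/or3P => [/eqP/val_inj zb|czb|czb]; rewrite lower_mid.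
- subst z; have Lb := lower_right.
  by case: ltnP => ?; [|case: ltnP => ?]; lab_lia.
- have cz' : cyc a z b by clear -czb cx; cyc_lia.
  have Lz := lower_in cz'.
  have sz' := side_label lab lab_ab cz'.
  by case: ltnP => ?; [|case: ltnP => ?]; lab_lia.
- have cz' : cyc b z a by clear -czb cy; cyc_lia.
  have Lz := lower_out cz'.
  have sz' := side_label' lab lab_ab cz'.
  move=> Kz; have zx : lam z < lam x.
    by move: Kz; case: ltnP => ?; [|case: ltnP => ?]; lab_lia.
  apply: (IH x z y) => //.
  + have nzy : z != y :> nat by clear -cz; cyc_lia.
    by have := cdD cz; have := cd_gt0 nzy; clear -lem; lia.
  + by clear -cz; cyc_lia.
  rewrite lower_mid; have -> : (lam x < lam y) = false by lab_lia.
  by case: ltnP; rewrite ?Ly ?Lz.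
Qed.

(** If [ab] is missing, the crossing edge [xy] nearest to [a] spans a triangle with [a]. Its middle
    is lower if [x] has the smaller label and not lower otherwise, so one of the two impossible
    walks can start there. *)
Lemma lower_closed_edge E :
  maximal_noncrossing E -> lower_closed E -> E a b.
Proof.
move=> mE H; have symE := mnc_sym mE.
have nab : a != b by apply/eqP => ab; move: lab_ab; rewrite ab ltnn.
apply/negPn/negP => /(first_crossing mE nab)[x [y [cx cy exy eax eya]]].
have cw : cyc y a x by clear -cx cy; cyc_lia.
have Lx := lower_in cx; have Ly := lower_out cy; have La := lower_left.
have sx := side_label lab lab_ab cx; have sy := side_label' lab lab_ab cy.
have : lam x != lam y by rewrite -(lab_neq lab); clear -cw; cyc_lia.
case: (ltngtP (lam x) (lam y)) => // xy _.
  apply: (strip_walk_down mE H cx cy xy cw) => //.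
  by rewrite lower_mid; case: ltnP => ?; [|case: ltnP => ?]; lab_lia.
apply: (strip_walk_up mE H cx cy xy cw) => //.
by rewrite lower_mid; case: ltnP => ?; [|case: ltnP => ?]; lab_lia.
Qed.

(** Only the endpoints need an argument: if the middle is [a], some vertex of the triangle lies
    below [ab] and has a smaller label, which forces [a] up and hence lower; likewise for [b]. *)
Lemma mid_lower u v z :
  (forall k, k \in [:: u; v; z] -> [|| k == a, k == b | cyc a k b]) ->
  lam u < lam v -> lam z != lam u -> lam z != lam v -> lower (mid lam u v z).
Proof.
move=> H uv zu zv; rewrite lower_mid.
have K k : k \in [:: u; v; z] -> [|| (lam k == lam a), (lam k == lam b) |
   [|| (lam k < lam a) && ~~ dn a, [&& lam a < lam k, lam k < lam b & dn k]
    | (lam b < lam k) && ~~ dn b]].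
  move=> /H/or3P[/eqP->|/eqP->|c]; rewrite ?eqxx ?orbT //.
  by rewrite (side_label lab lab_ab c) !orbT.
have L k : k \in [:: u; v; z] ->
    [|| (lam k == lam a) && (lower k == ~~ dn a),
        (lam k == lam b) && (lower k == ~~ dn b) | lower k].
  move=> /H/or3P[/eqP->|/eqP->|/lower_in->]; rewrite ?lower_left ?lower_right ?eqxx ?orbT //.
have [mu mv mz] : [/\ u \in [:: u; v; z], v \in [:: u; v; z] & z \in [:: u; v; z]].
  by rewrite !inE !eqxx !orbT.
have Ku := K u mu; have Kv := K v mv; have Kz := K z mz.
have Lu := L u mu; have Lv := L v mv; have Lz := L z mz.
by case: ltnP => ?; [|case: ltnP => ?]; lab_lia.
Qed.

Lemma mid_not_lower u v z :
  (forall k, k \in [:: u; v; z] -> [|| k == a, k == b | cyc b k a]) ->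
  lam u < lam v -> lam z != lam u -> lam z != lam v -> ~~ lower (mid lam u v z).
Proof.
move=> H uv zu zv; rewrite lower_mid.
have K k : k \in [:: u; v; z] -> [|| (lam k == lam a), (lam k == lam b) |
   [|| (lam k < lam a) && dn a, [&& lam a < lam k, lam k < lam b & ~~ dn k]
    | (lam b < lam k) && dn b]].
  move=> /H/or3P[/eqP->|/eqP->|c]; rewrite ?eqxx ?orbT //.
  by rewrite (side_label' lab lab_ab c) !orbT.
have L k : k \in [:: u; v; z] ->
    [|| (lam k == lam a) && (lower k == ~~ dn a),
        (lam k == lam b) && (lower k == ~~ dn b) | ~~ lower k].
  move=> /H/or3P[/eqP->|/eqP->|/lower_out->]; rewrite ?lower_left ?lower_right ?eqxx ?orbT //.
have [mu mv mz] : [/\ u \in [:: u; v; z], v \in [:: u; v; z] & z \in [:: u; v; z]].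
  by rewrite !inE !eqxx !orbT.
have Ku := K u mu; have Kv := K v mv; have Kz := K z mz.
have Lu := L u mu; have Lv := L v mv; have Lz := L z mz.
by case: ltnP => ?; [|case: ltnP => ?]; lab_lia.
Qed.

End LowerSet.

(** * Triangulations as maximal noncrossing graphs *)

Section Polygon.
Variable N : nat.
Implicit Types (u v w x y z : 'I_N) (d : {set 'I_N}) (D T : {set {set 'I_N}}).

Lemma set2_eqP u v x y : reflect ((u = x /\ v = y) \/ (u = y /\ v = x))
  ([set u; v] == [set x; y]).
Proof.
apply: (iffP eqP) => [e|[[-> ->]|[-> ->]]]; [|by []|by rewrite setUC].
have hu : u \in [set x; y] by rewrite -e set21.
have hv : v \in [set x; y] by rewrite -e set22.
have hx : x \in [set u; v] by rewrite e set21.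
have hy : y \in [set u; v] by rewrite e set22.
by move: hu hv hx hy; rewrite !inE; do 4!(case/orP => /eqP ?); subst; auto.
Qed.

Definition crosses u v x y : bool :=
  cyc u x v && cyc v y u || cyc u y v && cyc v x u.

Lemma crossing_cyc u v x y : crossing [set u; v] [set x; y] = crosses u v x y.
Proof.
apply/idP/idP.
  by case/orP; case/existsP => a /existsP[b /existsP[c /existsP[f]]];
    case/and5P => ab bc cf /set2_eqP[][-> ->] /set2_eqP[][-> ->];
    rewrite /crosses; cyc_lia.
have symc p q r s : crosses p q r s = crosses q p r s.
  by rewrite /crosses; cyc_lia.
have symc' p q r s : crosses p q r s = crosses p q s r.
  by rewrite /crosses; cyc_lia.
wlog uv : u v / u < v.
  move=> H c; case: (ltngtP u v) => [/H|/H|/val_inj uv]; first exact.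
    by rewrite (setUC [set v]); apply; rewrite symc.
  by move: c; rewrite uv /crosses; cyc_lia.
wlog xy : x y / x < y.
  move=> H c; case: (ltngtP x y) => [/H|/H|/val_inj xy]; first exact.
    by rewrite (setUC [set y]); apply; rewrite symc'.
  by move: c; rewrite xy /crosses; cyc_lia.
move=> c; have /orP[/and3P[h1 h2 h3]|/and3P[h1 h2 h3]] :
  [&& u < x, x < v & v < y] || [&& x < u, u < y & y < v].
  by move: c; rewrite /crosses; cyc_lia.
- apply/orP; left; apply/existsP; exists u; apply/existsP; exists x.
  by apply/existsP; exists v; apply/existsP; exists y; rewrite h1 h2 h3 !eqxx.
- apply/orP; right; apply/existsP; exists x; apply/existsP; exists u.
  by apply/existsP; exists y; apply/existsP; exists v; rewrite h1 h2 h3 !eqxx.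
Qed.

Definition edge D u v : bool := ([set u; v] \in D) || boundary_edge [set u; v].

Lemma edge_sym D : symmetric (edge D).
Proof. by move=> u v; rewrite /edge setUC. Qed.

Lemma boundary_edgeP u v :
  reflect (v = ordS u \/ u = ordS v) (boundary_edge [set u; v]).
Proof.
apply: (iffP existsP) => [[w /set2_eqP[][-> ->]]|[]->]; auto.
- by exists u.
- by exists v; rewrite setUC.
Qed.

Lemma boundary_not_crosses u v x y :
  boundary_edge [set u; v] -> crosses u v x y = false.
Proof.
case/boundary_edgeP => ->; rewrite /crosses !ordS_adjacent ?andbF //.
Qed.

Lemma crosses_sym u v x y : crosses u v x y = crosses x y u v.
Proof. by rewrite /crosses; cyc_lia. Qed.

Lemma crossing_sym d e : crossing d e = crossing e d.
Proof. exact: orbC. Qed.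

Lemma diagonal_set2 d : diagonal d ->
  exists u v, [/\ d = [set u; v], u < v & ~~ boundary_edge [set u; v]].
Proof.
case/andP => /cards2P[u [v [uv ->]]] nb.
case: (ltngtP u v) => [h|h|/val_inj h]; last by rewrite h eqxx in uv.
  by exists u, v.
by exists v, u; split; rewrite // setUC.
Qed.

Lemma noncrossingP D : reflect
  ({in D, forall d, diagonal d} /\ {in D &, forall d e, ~~ crossing d e})
  (noncrossing_diagonals D).
Proof.
apply: (iffP andP) => -[h1 h2]; split.
- by move=> d dD; apply: (forall_inP h1).
- by move=> d e dD eD; apply: (forall_inP (forall_inP h2 d dD)).
- exact/forall_inP.
- by apply/forall_inP => d dD; apply/forall_inP => e eD; apply: h2.
Qed.

Lemma crosses_diagonal u v x y : crosses u v x y -> diagonal [set u; v].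
Proof.
move=> c; rewrite /diagonal cards2.
have -> : u != v by apply/eqP => uv; move: c; rewrite uv /crosses; cyc_lia.
by apply/negP => /(boundary_not_crosses x y); rewrite c.
Qed.

Lemma noncrossingU1 D d : noncrossing_diagonals D -> diagonal d ->
  {in D, forall e, ~~ crossing d e} -> noncrossing_diagonals (d |: D).
Proof.
case/noncrossingP => dD nD dd dn; apply/noncrossingP; split.
  by move=> e /setU1P[->//|/dD].
have [u [v [dE _ _]]] := diagonal_set2 dd.
move=> e f /setU1P[->|eD] /setU1P[->|fD]; last exact: nD.
- by rewrite dE crossing_cyc /crosses; cyc_lia.
- exact: dn.
- by rewrite crossing_sym dn.
Qed.

Hypothesis N3 : 2 < N.

Lemma ordS_neq u : ordS u != u :> nat.
Proof. by have := ltn_ord u; rewrite val_ordS; case: (u.+1 =P N); lia. Qed.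

Lemma diagonal_cyc u v : u != v -> ~~ boundary_edge [set u; v] ->
  cyc u (ordS u) v.
Proof.
move=> uv nb; have : v != ordS u.
  by apply: contraNneq nb => ->; apply/boundary_edgeP; left.
have := ordS_adjacent u v; have := ordS_neq u; move: (ordS u) uv => s.
by rewrite -!val_eqE /=; clear; cyc_lia.
Qed.

Lemma edge_irr D : {in D, forall d, diagonal d} -> irreflexive (edge D).
Proof.
move=> dD u; apply/negbTE; rewrite negb_or; apply/andP; split.
  by apply/negP => /dD/andP[]; rewrite setUid cards1.
by apply/negP => /boundary_edgeP[]/(congr1 val)/eqP;
  rewrite eq_sym; apply/negP/ordS_neq.
Qed.

Lemma edge_noncrossing D u v x y : noncrossing_diagonals D ->
  edge D u v -> edge D x y -> crosses u v x y = false.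
Proof.
case/noncrossingP => dD nD /orP[uv|/boundary_not_crosses-> //].
case/orP=> [xy|/boundary_not_crosses h]; last by rewrite crosses_sym h.
by rewrite -crossing_cyc; apply/negbTE/nD.
Qed.

(** The boundary edge from [0] to [N - 1] is added as a root. In a triangulation, each chord joins
    the smallest and largest vertex of exactly one triangle, and the middle vertex of that triangle
    is one of the [N - 2] inner ones. *)
Definition chords D : {set 'I_N * 'I_N} :=
  [set p : 'I_N * 'I_N | (p.1 < p.2) &&
    (([set p.1; p.2] \in D) || (p.1 == 0 :> nat) && (p.2 == N.-1 :> nat))].

Lemma card_chords D : {in D, forall d, diagonal d} -> #|chords D| = #|D|.+1.
Proof.
move=> dD; have N0 : 0 < N by lia. have N1 : N.-1 < N by lia.
pose z := Ordinal N0; pose t := Ordinal N1.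
have <- : #|(fun p : 'I_N * 'I_N => [set p.1; p.2]) @: chords D| = #|chords D|.
  apply: card_in_imset => -[a b] [c e]; rewrite !inE /= => /andP[ab _] /andP[ce _].
  move/eqP/set2_eqP => [][ac be]; first by rewrite ac be.
  by move: ab ce; rewrite ac be; lia.
have -> : (fun p : 'I_N * 'I_N => [set p.1; p.2]) @: chords D = [set z; t] |: D.
  apply/setP => d; rewrite !inE; apply/imsetP/orP => [[[a b]]|].
    rewrite !inE /= => /andP[ab /orP[h ->|/andP[/eqP az /eqP bt] ->]].
      by right.
    have -> : a = z by apply: val_inj. have -> : b = t by apply: val_inj.
    by left.
  case=> [/eqP->|dD'].
    by exists (z, t) => //; rewrite inE /= !eqxx orbT andbT; lia.
  have [u [v [dE uv _]]] := diagonal_set2 (dD _ dD').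
  by exists (u, v) => //; rewrite inE /= uv -dE dD'.
rewrite cardsU1; suff -> : [set z; t] \notin D by [].
apply/negP => /dD/andP[_ /negP]; apply; apply/boundary_edgeP; right.
by apply: ord_inj; rewrite val_ordS /= prednK ?eqxx.
Qed.

Lemma card_inner : #|[set k : 'I_N | 0 < k < N.-1]| = N - 2.
Proof.
have N0 : 0 < N by lia. have N1 : N.-1 < N by lia.
pose z := Ordinal N0; pose t := Ordinal N1.
have -> : [set k : 'I_N | 0 < k < N.-1] = ~: [set z; t].
  apply/setP => k; rewrite !inE -!val_eqE /=; have := ltn_ord k; lia.
have := cardsC [set z; t]; rewrite cards2 card_ord -val_eqE /=; lia.
Qed.

(** Each chord is sent to the largest neighbour of its smaller endpoint strictly inside it. Suppose
    two chords have the same image. If their smaller endpoints differ, an edge crosses one of them;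
    otherwise the shorter chord gives the longer one a larger neighbour. *)
Lemma card_noncrossing D : noncrossing_diagonals D -> #|D| <= N - 3.
Proof.
move=> ncD; have [dD nD] := noncrossingP _ ncD.
suff : #|chords D| <= N - 2 by rewrite card_chords //; lia.
rewrite -card_inner.
pose P (p : 'I_N * 'I_N) (k : 'I_N) := (p.1 < k < p.2) && edge D p.1 k.
pose f p : 'I_N := [arg max_(k > ordS p.1 | P p k) (k : nat)].
have long p : p \in chords D -> p.1.+1 < p.2.
  rewrite inE => /andP[lt /orP[/dD/andP[_ nb]|/andP[/eqP e1 /eqP e2]]]; last by rewrite e1 e2; clear -N3; lia.
  rewrite ltn_neqAle lt andbT; apply: contraNneq nb => e.
  apply/boundary_edgeP; left; apply: ord_inj; rewrite val_ordS -e.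
  by have := ltn_ord p.2; rewrite -e => h; rewrite ltn_eqF.
have fP p : p \in chords D ->
    P p (f p) /\ forall k, P p k -> k <= f p.
  move=> pD; rewrite /f; case: arg_maxnP => //.
  rewrite /P /edge; apply/andP; split; last first.
    by apply/orP; right; apply/boundary_edgeP; left.
  have h := long p pD; rewrite val_ordS ltn_eqF ?ltnSn //=.
  exact: ltn_trans h (ltn_ord p.2).
have injf : {in chords D &, injective f}.
  move=> p q pD qD fpq; have [/andP[p1 p2] p3] := fP _ pD.
  have [/andP[q1 q2] q3] := fP _ qD; rewrite -fpq in q1 q2 q3.
  have noteq (p' q' : 'I_N * 'I_N) (k : 'I_N) : p'.1 < q'.1 -> p' \in chords D ->
      q' \in chords D -> p'.1 < k < p'.2 -> edge D p'.1 k ->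
      q'.1 < k < q'.2 -> False.
    move=> lt _; rewrite inE => /andP[_ /orP[q'D|/andP[/eqP q'0 _]]].
      2: by rewrite q'0 in lt.
    move=> kp ek kq; have e' : edge D q'.1 q'.2 by rewrite /edge q'D.
    have := edge_noncrossing ncD ek e'; rewrite /crosses; clear -lt kp kq.
    by cyc_lia.
  have p1q1 : p.1 = q.1.
    case: (ltngtP p.1 q.1) => [h|h|/val_inj //].
      by case: (noteq p q (f p)).
    by case: (noteq q p (f p)).
  have half (p' q' : 'I_N * 'I_N) (k : 'I_N) : p'.1 = q'.1 -> p'.2 < q'.2 ->
      p' \in chords D -> (forall j, P q' j -> j <= k) -> k < p'.2 -> False.
    move=> e lt; rewrite inE => /andP[lt' /orP[p'D|/andP[_ /eqP p't]]]; last first.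
      by have := ltn_ord q'.2; move: lt; rewrite p't; clear; lia.
    move=> H; have := H p'.2; rewrite /P -e lt lt' /edge p'D => /(_ isT).
    by rewrite leqNgt => /negP.
  case: (ltngtP p.2 q.2) => [h|h|/val_inj p2q2].
  - by case: (half p q (f p)) => //; case/andP: p1.
  - by case: (half q p (f p)) => //; case/andP: q1.
  - by case: p q p1q1 p2q2 {pD qD fpq p1 p2 p3 q1 q2 q3} => ? ? [? ?] /= -> ->.
rewrite -(card_in_imset injf).
apply/subset_leq_card/subsetP => k /imsetP[p pD ->].
have [/andP[/andP[h1 h2] _] _] := fP _ pD; rewrite inE (leq_ltn_trans _ h1) //=.
have N0 : 0 < N by lia.
by apply: leq_trans h2 _; rewrite -ltnS prednK.
Qed.

(** The reverse count: every inner vertex is the middle of a triangle whose outer side is a chord,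
    and two middles for one chord would give crossing edges. *)
Lemma maximal_card D : noncrossing_diagonals D ->
  maximal_noncrossing (edge D) -> #|D| = N - 3.
Proof.
move=> ncD mD; have [dD nD] := noncrossingP _ ncD.
apply/eqP; rewrite eqn_leq card_noncrossing //=.
suff : N - 2 <= #|chords D| by rewrite card_chords // !leq_subLR addnS.
rewrite -card_inner.
(* Labelling the vertices by position, all of them down, makes [mid_triangle] available. *)
have lab : labelling (fun u : 'I_N => val u) predT.
  by split=> [|u v w]; [exact: val_inj|rewrite /=; cyc_lia].
pose P (k : 'I_N) (p : 'I_N * 'I_N) := [&& p \in chords D, p.1 < k < p.2,
  edge D p.1 k & edge D k p.2].
have exP k : k \in [set k : 'I_N | 0 < k < N.-1] -> exists p, P k p.
  rewrite inE => /andP[k0 kN].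
  have N0 : 0 < N by lia. have N1 : N.-1 < N by lia.
  have [a [b [ak kb e1 e2 e3]]] :=
    mid_triangle lab mD (a0 := Ordinal N0) (v := k) (b0 := Ordinal N1) k0 kN.
  exists (a, b); rewrite /P inE /= ak kb e1 e2 !andbT.
  (* The only boundary edge with an inner vertex between its ends is the root. *)
  rewrite (ltn_trans ak kb) /=; case/orP: e3 => [->//|/boundary_edgeP].
  rewrite /= in ak kb.
  have := ltn_ord a; have := ltn_ord b => hb ha.
  case=> /(congr1 (@nat_of_ord N)); rewrite val_ordS.
    by case: (a.+1 =P N) => _ eb; exfalso; clear -ak kb eb; lia.
  case: (b.+1 =P N) => bN ea; last by exfalso; clear -ak kb ea; lia.
  have -> : N.-1 = b by rewrite -[N.-1]/(N.-1) -(congr1 predn bN).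
  by rewrite ea !eqxx orbT.
pose f k := odflt (k, k) [pick p | P k p].
have fP k : k \in [set k : 'I_N | 0 < k < N.-1] -> P k (f k).
  move=> /exP[p pP]; rewrite /f; case: pickP => //= h.
  by rewrite h in pP.
have injf : {in [set k : 'I_N | 0 < k < N.-1] &, injective f}.
  move=> k k' /fP/and4P[_ kk e1 e2] /fP/and4P[_ kk' e1' e2'] fk.
  rewrite -fk in kk' e1' e2'.
  case: (ltngtP k k') => [h|h|/val_inj//].
    have := edge_noncrossing ncD e1' e2; rewrite /crosses; clear -kk kk' h.
    by cyc_lia.
  have := edge_noncrossing ncD e1 e2'; rewrite /crosses; clear -kk kk' h.
  by cyc_lia.
rewrite -(card_in_imset injf).
by apply/subset_leq_card/subsetP => p /imsetP[k /fP/and4P[? _ _ _] ->].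
Qed.

Lemma maximal_noncrossing_edge D : noncrossing_diagonals D ->
  (forall d, diagonal d -> {in D, forall e, ~~ crossing d e} -> d \in D) ->
  maximal_noncrossing (edge D).
Proof.
move=> ncD maxD; have [dD nD] := noncrossingP _ ncD; split.
- exact: edge_sym.
- exact: edge_irr.
- move=> u v x y uv xy c1 c2; have := edge_noncrossing ncD uv xy.
  by rewrite /crosses c1 c2.
- move=> u v uv H; rewrite /edge; case: (boolP (boundary_edge _)) => [_|nb]; first by rewrite orbT.
  rewrite orbF.
  apply: maxD; first by rewrite /diagonal cards2 uv nb.
  move=> e eD; have [x [y [eE _ _]]] := diagonal_set2 (dD _ eD); subst e.
  rewrite crossing_cyc; apply/negP => /orP[]/andP[c1 c2].
    by apply: (H x y) => //; rewrite /edge eD.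
  by apply: (H y x) => //; rewrite /edge setUC eD.
Qed.

Lemma triangulation_maximal T :
  triangulation T -> maximal_noncrossing (edge T).
Proof.
case/andP => ncT /eqP cT; apply: maximal_noncrossing_edge => // d dd nd.
apply/negPn/negP => dT; have := card_noncrossing (noncrossingU1 ncT dd nd).
by rewrite cardsU1 dT cT; lia.
Qed.

Lemma maximal_triangulation D : noncrossing_diagonals D ->
  maximal_noncrossing (edge D) -> triangulation D.
Proof. by move=> ncD mD; rewrite /triangulation ncD maximal_card //=. Qed.

End Polygon.

(** * Flipping a diagonal of a triangulation *)

Section Flip.
Variable N : nat.
Hypothesis N3 : 2 < N.
Implicit Types (u v w x y z : 'I_N) (d : {set 'I_N}) (D T : {set {set 'I_N}}).

(** An edge crossing [zy] cannot leave the quadrilateral, since it would cross a side; so it joins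
    the other two corners. *)
Lemma quadrilateral_crossing E u z v y p q : maximal_noncrossing E ->
  cyc u z v -> cyc v y u -> E u z -> E z v -> E v y -> E y u ->
  E p q -> crosses z y p q -> [set p; q] = [set u; v].
Proof.
move=> mE cz cy uz zv vy yu pq; have symE := mnc_sym mE.
have H p' q' : E p' q' -> cyc z p' y -> cyc y q' z -> p' = v /\ q' = u.
  move=> pq' c1 c2; split.
    have /or3P[/eqP/val_inj //|c|c] :
      [|| p' == v :> nat, cyc z p' v | cyc v p' y] by clear -c1 c2 cz cy; cyc_lia.
    - by case: (mnc_noncrossing mE zv pq' c); clear -c1 c2 cz cy c; cyc_lia.
    - by case: (mnc_noncrossing mE vy pq' c); clear -c1 c2 cz cy c; cyc_lia.
  rewrite symE in pq'.
  have /or3P[/eqP/val_inj //|c|c] :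
    [|| q' == u :> nat, cyc y q' u | cyc u q' z] by clear -c1 c2 cz cy; cyc_lia.
  - by case: (mnc_noncrossing mE yu pq' c); clear -c1 c2 cz cy c; cyc_lia.
  - by case: (mnc_noncrossing mE uz pq' c); clear -c1 c2 cz cy c; cyc_lia.
case/orP => /andP[c1 c2].
  by have [-> ->] := H _ _ pq c1 c2; rewrite setUC.
by rewrite symE in pq; have [-> ->] := H _ _ pq c1 c2.
Qed.

Definition flip T u v z y := [set z; y] |: (T :\ [set u; v]).

Section FlipEdge.
Variables (T : {set {set 'I_N}}) (u v z y : 'I_N).
Hypotheses (triT : triangulation T) (cz : cyc u z v) (cy : cyc v y u)
  (uv : edge T u v) (uz : edge T u z) (zv : edge T z v)
  (vy : edge T v y) (yu : edge T y u).
Let mT := triangulation_maximal N3 triT.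

Lemma quad_crosses : crosses u v z y.
Proof. by rewrite /crosses cz cy. Qed.

Lemma flip_edge_mem : [set u; v] \in T.
Proof.
by case/orP: uv => // /(boundary_not_crosses z y); rewrite quad_crosses.
Qed.

Lemma flip_noncrossing e : e \in T -> e != [set u; v] -> ~~ crossing [set z; y] e.
Proof.
move=> eT ne; have [/andP[/noncrossingP[dT _] _]] := triT.
have [p [q [eE _ _]]] := diagonal_set2 (dT _ eT).
rewrite eE crossing_cyc; apply: contraNN ne => c; rewrite eE.
by apply/eqP/(quadrilateral_crossing mT cz cy) => //; rewrite /edge -eE eT.
Qed.

Lemma flip_new : [set z; y] \notin T.
Proof.
apply/negP => zyT; have zy : edge T z y by rewrite /edge zyT.
have := edge_noncrossing (proj1 (andP triT)) uv zy.
by rewrite quad_crosses.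
Qed.

Lemma triangulation_flip : triangulation (flip T u v z y).
Proof.
have /andP[ncT /eqP cT] := triT; have [dT nT] := noncrossingP _ ncT.
apply/andP; split.
  apply: noncrossingU1.
  - apply/noncrossingP; split; first by move=> d /setD1P[_ /dT].
    by move=> d e /setD1P[_ ?] /setD1P[_ ?]; apply: nT.
  - by apply: (@crosses_diagonal _ _ _ u v); rewrite crosses_sym quad_crosses.
  - by move=> e /setD1P[ne eT]; apply: flip_noncrossing.
have := cardsD1 [set u; v] T; rewrite flip_edge_mem cT => cT'.
rewrite cardsU1 inE (negbTE flip_new) andbF /= eq_sym.
by rewrite cT' in cT *; rewrite -cT'.
Qed.

Lemma edge_flip p q :
  edge T p q -> edge (flip T u v z y) p q \/ [set p; q] = [set u; v].
Proof.
rewrite /edge /flip !inE => /orP[pq|->]; last by left; rewrite orbT.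
case: eqVneq => [->|_]; first by left.
by case: (eqVneq [set p; q] [set u; v]) => [->|_]; [right|left; rewrite pq].
Qed.

Lemma edge_flip_new : edge (flip T u v z y) z y.
Proof. by rewrite /edge /flip !inE eqxx. Qed.

End FlipEdge.
End Flip.

(** * The minima of the functional of a diagonal *)

Section FacetFunctional.
Variables (N : nat) (lam : 'I_N -> nat) (dn : pred 'I_N).
Implicit Types (u v w x y z : 'I_N) (d : {set 'I_N}) (D T F : {set {set 'I_N}}).
Hypothesis N3 : 2 < N.
Hypothesis lab : labelling lam dn.
Variable W : {set {set 'I_N}} -> 'I_N -> nat.
Hypothesis wW : forall T, triangulation T -> mid_weight lam dn (edge T) (W T).

Definition inner k : bool :=
  [exists x, lam x < lam k] && [exists y, lam k < lam y].

Lemma inner_mid u v z : lam u < lam v -> lam z != lam u -> lam z != lam v ->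
  inner (mid lam u v z).
Proof.
move=> uv zu zv; rewrite /mid /inner.
case: (ltnP (lam z) (lam u)) => zu'; last case: (ltnP (lam v) (lam z)) => zv'.
- by apply/andP; split; apply/existsP; [exists z|exists v].
- by apply/andP; split; apply/existsP; [exists u|exists z].
- by apply/andP; split; apply/existsP; [exists u|exists v]; rewrite ltn_neqAle
    ?zu' ?zv' ?andbT // eq_sym.
Qed.

Variables a b : 'I_N.
Hypothesis lab_ab : lam a < lam b.
Local Notation lower := (lower dn a b).

Definition facet_sum T : int :=
  (\sum_(k | inner k && lower k) tri_coord dn (W T) k)%R.

Lemma facet_sum_flip T u v z y : triangulation T -> lam u < lam v ->
    cyc u z v -> cyc v y u -> edge T u v -> edge T u z -> edge T z v ->
    edge T v y -> edge T y u ->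
  exists t : int, (0 < t)%R /\
    facet_sum (flip T u v z y) =
      (facet_sum T + t *+ lower (mid lam u v z) - t *+ lower (mid lam u v y))%R.
Proof.
move=> triT uv cz cy euv euz ezv evy eyu.
have mT := triangulation_maximal N3 triT.
have triT' := triangulation_flip N3 triT cz cy euv euz ezv evy eyu.
have [t [t0 ti tj tk]] := flip_coord lab mT (@edge_sym _ _) (wW triT) (wW triT')
  uv cz cy euv euz ezv evy eyu (edge_flip_new T u v z y) (@edge_flip _ T u v z y).
exists t; split=> //.
have zu : lam z != lam u by rewrite -(lab_neq lab); clear -cz; cyc_lia.
have zv : lam z != lam v by rewrite -(lab_neq lab); clear -cz; cyc_lia.
have yu : lam y != lam u by rewrite -(lab_neq lab); clear -cy; cyc_lia.
have yv : lam y != lam v by rewrite -(lab_neq lab); clear -cy; cyc_lia.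
have := inner_mid uv zu zv; have := inner_mid uv yu yv.
move: (mid lam u v z) (mid lam u v y) ti tj tk => i j ti tj tk inj ini.
(* A common middle would have its coordinate both raised and lowered by [t > 0]. *)
have ij : i != j.
  apply/eqP => ij; move: ti tj; rewrite ij => -> /addrI/eqP.
  by rewrite -subr_eq0 opprK; apply/negP; rewrite gt_eqF // addr_gt0.
have sum1 (l : 'I_N) : inner l ->
    (\sum_(k | inner k && lower k) t *+ (k == l))%R = (t *+ lower l)%R.
  move=> il; case Ll: (lower l).
    rewrite (bigD1 l) ?il ?Ll //= eqxx big1 ?addr0 // => k /andP[_ /negbTE->].
    by [].
  by rewrite big1 // => k /andP[_ Lk]; case: eqP => // kl; rewrite kl Ll in Lk.
rewrite -(sum1 i) // -(sum1 j) // /facet_sum -big_split -sumrB /=.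
apply: eq_bigr => k /andP[/andP[/existsP[p pk] /existsP[q kq]] _].
case: eqVneq => [->|ki]; first by rewrite ti (negbTE ij) subr0.
case: eqVneq => [->|kj]; first by rewrite tj addr0.
by rewrite addr0 subr0 /tri_coord (tk p k q).
Qed.

Hypothesis diag_ab : diagonal [set a; b].

Lemma edge_facet T : edge T a b = ([set a; b] \in T).
Proof. by rewrite /edge; case/andP: diag_ab => _ /negbTE->; rewrite orbF. Qed.

Lemma facet_minimizer T : triangulation T ->
  (forall T', triangulation T' -> (facet_sum T <= facet_sum T')%R) ->
  [set a; b] \in T.
Proof.
move=> triT minT; have mT := triangulation_maximal N3 triT.
rewrite -edge_facet; apply: (lower_closed_edge lab lab_ab mT).
move=> u v z y uv cz cy euv euz ezv evy eyu Ly; apply/negPn/negP => nLz.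
have [t [t0]] := facet_sum_flip triT uv cz cy euv euz ezv evy eyu.
rewrite Ly (negbTE nLz) mulr0n addr0 mulr1n => E.
have := minT _ (triangulation_flip N3 triT cz cy euv euz ezv evy eyu).
by rewrite E leNgt ltrBlDr ltrDl t0.
Qed.

Let nab : a != b. Proof. by apply/eqP => e; move: lab_ab; rewrite e ltnn. Qed.

(** While some vertex is not joined to [a], the edge [pq] opposite [a] in a triangle at [a] is
    flipped. As [pq] does not cross [ab], the quadrilateral lies on one side of [ab]: both middles
    are lower or neither is. The sum is kept, and [a] gains a neighbour. *)
Lemma facet_sum_fan T : triangulation T -> [set a; b] \in T ->
  exists F, [/\ triangulation F, forall x, x != a -> edge F a x &
    facet_sum F = facet_sum T].
Proof.
pose deg T := #|[set x | edge T a x]|.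
have [m] := ubnP (N - deg T); elim: m T => // m IH T lem triT dT.
have mT := triangulation_maximal N3 triT; have symT := mnc_sym mT.
have [x /andP[xa nax]|full] := pickP [pred x | (x != a) && ~~ edge T a x]; last first.
  exists T; split=> // x xa; have := full x; rewrite /= xa /=.
  by move/negbT; rewrite negbK.
rewrite eq_sym in xa.
have [p [q [cp cq pq ap qa]]] := first_crossing mT xa nax.
have cpq : cyc p x q by clear -cp cq; cyc_lia.
have [y [cy py yq]] := side_triangle mT pq cpq.
have cqa : cyc q a p by clear -cp cq; cyc_lia.
have qp : edge T q p by rewrite symT.
have pa : edge T p a by rewrite symT.
have aq : edge T a q by rewrite symT.
have qy : edge T q y by rewrite symT.
have yp : edge T y p by rewrite symT.
have ab : edge T a b by rewrite edge_facet.
have nb : ~~ cyc p b q.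
  apply/negP => c; apply: (mnc_noncrossing mT pq) (c) _; first by rewrite symT; exact: ab.
  exact: cqa.
have /orP side : (b == q :> nat) || cyc q b a || ((b == p :> nat) || cyc a b p).
  move: nab; rewrite -val_eqE /= => nab'; clear -nab' nb cqa; cyc_lia.
have npq : lam p != lam q by rewrite -(lab_neq lab); clear -cy; cyc_lia.
have neqs : [/\ lam a != lam p, lam a != lam q, lam y != lam p & lam y != lam q].
  by rewrite -!(lab_neq lab); split; clear -cy cqa; cyc_lia.
have [ap' aq' yp' yq'] := neqs.
have Leq u v : [set u; v] = [set p; q] -> lam u < lam v ->
    lower (mid lam u v a) = lower (mid lam u v y).
  move=> uvE uv.
  have au : lam a != lam u.
    by have := set21 u v; rewrite uvE !inE => /orP[]/eqP->.
  have av : lam a != lam v.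
    by have := set22 u v; rewrite uvE !inE => /orP[]/eqP->.
  have yu : lam y != lam u.
    by have := set21 u v; rewrite uvE !inE => /orP[]/eqP->.
  have yv : lam y != lam v.
    by have := set22 u v; rewrite uvE !inE => /orP[]/eqP->.
  have mem k : k \in [:: u; v] -> k \in [:: p; q].
    have := set21 u v; have := set22 u v; rewrite uvE !inE.
    by move=> h1 h2 /orP[]/eqP->.
  case: side => side.
    transitivity true; last apply/esym; apply: (mid_lower lab lab_ab) => // k.
      rewrite !inE orbA => /orP[|/eqP->]; last by rewrite eqxx.
      move=> kuv; have := mem k; rewrite !inE kuv => /(_ isT).
      by rewrite -!val_eqE /= => /orP[]/eqP->; clear -side cy cqa; cyc_lia.
    rewrite !inE orbA => /orP[|/eqP->]; last first.
      by rewrite -!val_eqE /=; clear -side cy cqa; cyc_lia.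
    move=> kuv; have := mem k; rewrite !inE kuv => /(_ isT).
    by rewrite -!val_eqE /= => /orP[]/eqP->; clear -side cy cqa; cyc_lia.
  transitivity false; [|apply/esym]; apply/negbTE;
    apply: (mid_not_lower lab lab_ab) => // k.
    rewrite !inE orbA => /orP[|/eqP->]; last by rewrite eqxx.
    move=> kuv; have := mem k; rewrite !inE kuv => /(_ isT).
    by rewrite -!val_eqE /= => /orP[]/eqP->; clear -side cy cqa; cyc_lia.
  rewrite !inE orbA => /orP[|/eqP->]; last first.
    by rewrite -!val_eqE /=; clear -side cy cqa; cyc_lia.
  move=> kuv; have := mem k; rewrite !inE kuv => /(_ isT).
  by rewrite -!val_eqE /= => /orP[]/eqP->; clear -side cy cqa; cyc_lia.
have a_pq : a \notin [set p; q].
  by rewrite !inE -!val_eqE /=; clear -cqa; cyc_lia.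
have step T' : triangulation T' -> edge T' a y ->
    (forall r s, edge T r s -> edge T' r s \/ [set r; s] = [set p; q]) ->
    facet_sum T' = facet_sum T ->
  exists F, [/\ triangulation F, forall x, x != a -> edge F a x &
    facet_sum F = facet_sum T].
  move=> triT' ay' sub sumE.
  have sub' s : edge T a s -> edge T' a s.
    by move=> /sub[//|e]; move: a_pq; rewrite -e set21.
  have dT' : [set a; b] \in T' by rewrite -edge_facet sub'.
  have [|F [triF fullF FE]] := IH T' _ triT' dT'; last first.
    by exists F; rewrite FE.
  have nay : ~~ edge T a y.
    apply/negP => ay; apply: (mnc_noncrossing mT pq _ cy cqa).
    by rewrite symT.
  have : deg T < deg T'.
    apply: proper_card; apply/properP; split.
      by apply/subsetP => s; rewrite !inE; apply: sub'.
    by exists y; rewrite inE.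
  have : deg T' <= N by rewrite -[X in _ <= X]card_ord max_card.
  by move: lem; clear; lia.
(* The flip formula takes the endpoint with the smaller label first. *)
case: (ltngtP (lam p) (lam q)) npq => // pq' _.
- have [t [t0 sumE]] := facet_sum_flip triT pq' cy cqa pq py yq qa ap.
  apply: (step (flip T p q y a)).
  + exact: triangulation_flip.
  + by rewrite edge_sym edge_flip_new.
  + exact: edge_flip.
  + by rewrite sumE (Leq p q) // addrK.
- have [t [t0 sumE]] := facet_sum_flip triT pq' cqa cy qp qa ap py yq.
  apply: (step (flip T q p a y)).
  + exact: triangulation_flip.
  + by rewrite edge_flip_new.
  + by move=> r s /(@edge_flip _ T q p a y); rewrite (setUC [set p]).
  + by rewrite sumE (Leq q p) ?addrK // setUC.
Qed.

(** Every diagonal of a fan ends at [a]: any other would separate [a] from some vertex, whose edge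
    to [a] would cross it. *)
Lemma fan_uniq F F' : triangulation F -> triangulation F' ->
  (forall x, x != a -> edge F a x) -> (forall x, x != a -> edge F' a x) ->
  F \subset F'.
Proof.
move=> triF triF' fullF fullF'; have mF := triangulation_maximal N3 triF.
have [/andP[/noncrossingP[dF _] _]] := triF.
apply/subsetP => e eF; have [u [v [eE uv nb]]] := diagonal_set2 (dF _ eF).
have fin x : e = [set a; x] -> e \in F'.
  move=> ex; have nx : x != a.
    by apply: contraTneq (dF _ eF) => xa; rewrite ex xa setUid /diagonal cards1.
  have := fullF' x nx; rewrite /edge -ex.
  by case/andP: (dF _ eF) => _ /negbTE->; rewrite orbF.
have [ua|ua] := eqVneq u a; first by apply: (fin v); rewrite -ua.
have [va|va] := eqVneq v a; first by apply: (fin u); rewrite -va setUC.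
have euv : edge F u v by rewrite /edge -eE eF.
have bad p q : edge F p q -> p != q -> ~~ boundary_edge [set p; q] ->
    cyc q a p -> False.
  move=> epq pq nb' cqa; have c := diagonal_cyc N3 pq nb'.
  have xa : ordS p != a by apply: contraTneq c => ->; clear -cqa; cyc_lia.
  apply: (mnc_noncrossing mF epq _ c cqa).
  by rewrite (mnc_sym mF); apply: fullF.
have nuv : u != v by rewrite -val_eqE /= ltn_eqF.
have /orP[c|c] : cyc v a u || cyc u a v.
  by move: ua va uv; rewrite -!val_eqE /=; clear; cyc_lia.
  by case: (bad u v).
have evu : edge F v u by rewrite (mnc_sym mF).
by case: (bad v u) => //; [rewrite eq_sym|rewrite setUC].
Qed.

Lemma facet_functional : exists c : int, forall T, triangulation T ->
  (c <= facet_sum T)%R /\ (facet_sum T == c) = ([set a; b] \in T).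
Proof.
have [T0 tri0|no] := pickP (fun T => triangulation T); last first.
  by exists 0%R => T; rewrite no.
have [Tm trim minT] := Order.TotalTheory.arg_minP facet_sum tri0.
have dm := facet_minimizer trim minT.
exists (facet_sum Tm) => T triT; split; first exact: minT.
apply/eqP/idP => [e|dT].
  by apply: facet_minimizer => // T' triT'; rewrite e; apply: minT.
have [F [triF fullF <-]] := facet_sum_fan triT dT.
have [F' [triF' fullF' <-]] := facet_sum_fan trim dm.
congr facet_sum; apply/eqP; rewrite eqEsubset.
by rewrite !fan_uniq.
Qed.

End FacetFunctional.

(** * Central symmetry *)

Section HalfTurn.
Variable n : nat.
Local Notation N := (2 * n).+2.
Implicit Types (u v w x y z : 'I_N) (d e : {set 'I_N}) (D T : {set {set 'I_N}}).
Local Notation h := (@half_turn n).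

Lemma half_turnP u :
  u < n.+1 /\ h u = u + n.+1 :> nat \/ n.+1 <= u /\ h u + n.+1 = u.
Proof.
have it k : iter k (@ordS N) u = (u + k) %% N :> nat.
  elim: k => [|k IH] /=; first by rewrite addn0 modn_small.
  by rewrite IH -addn1 modnDml addn1 addnS.
have hE : h u = (u + n.+1) %% N :> nat by exact: it.
have := ltn_ord u; rewrite hE; case: (ltnP u n.+1) => un uN; [left|right].
  by rewrite modn_small //; lia.
have -> : u + n.+1 = (u - n.+1) + N by lia.
by rewrite modnDr modn_small; lia.
Qed.

Lemma half_turnK : involutive h.
Proof.
move=> u; apply: ord_inj; have := half_turnP u; have := half_turnP (h u).
have := ltn_ord u; lia.
Qed.

Lemma half_turn_inj : injective h. Proof. exact: can_inj half_turnK. Qed.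

Lemma cyc_half_turn u v w : cyc (h u) (h v) (h w) = cyc u v w.
Proof.
have := half_turnP u; have := half_turnP v; have := half_turnP w.
have := ltn_ord u; have := ltn_ord v; have := ltn_ord w.
move: (nat_of_ord (h u)) (nat_of_ord (h v)) (nat_of_ord (h w)); cyc_lia.
Qed.

Definition turn d : {set 'I_N} := h @: d.

Lemma turnK : involutive turn.
Proof.
by move=> d; rewrite /turn -imset_comp (eq_imset _ half_turnK) imset_id.
Qed.

Lemma turn_set2 u v : turn [set u; v] = [set h u; h v].
Proof. by rewrite /turn imsetU1 imset_set1. Qed.

Lemma boundary_turn d : boundary_edge (turn d) = boundary_edge d.
Proof.
have imp e : boundary_edge e -> boundary_edge (turn e).
  case/existsP => u /eqP->; rewrite turn_set2; apply/existsP; exists (h u).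
  by rewrite /half_turn -iterSr.
by apply/idP/idP => [/imp|/imp //]; rewrite turnK.
Qed.

Lemma diagonal_turn d : diagonal (turn d) = diagonal d.
Proof. by rewrite /diagonal boundary_turn card_imset //; exact: half_turn_inj. Qed.

Lemma crosses_turn u v x y : crosses (h u) (h v) (h x) (h y) = crosses u v x y.
Proof. by rewrite /crosses !cyc_half_turn. Qed.

Lemma crossing_turn d e : diagonal d -> diagonal e ->
  crossing (turn d) (turn e) = crossing d e.
Proof.
move=> /diagonal_set2[u [v [-> _ _]]] /diagonal_set2[x [y [-> _ _]]].
by rewrite !turn_set2 !crossing_cyc crosses_turn.
Qed.

(* The half-turn maps a chord to a parallel chord. *)
Lemma crossing_turn_self d : diagonal d -> ~~ crossing d (turn d).
Proof.
case/diagonal_set2 => u [v [-> uv _]]; rewrite turn_set2 crossing_cyc /crosses.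
have := half_turnP u; have := half_turnP v; have := ltn_ord v.
by move: (nat_of_ord (h u)) (nat_of_ord (h v)) => hu hv; cyc_lia.
Qed.

Lemma turn_centrally_symmetric D d :
  centrally_symmetric D -> (turn d \in D) = (d \in D).
Proof.
move=> /eqP csD; have imp e : e \in D -> turn e \in D.
  by move=> eD; rewrite -csD; apply/imsetP; exists e.
by apply/idP/idP => [/imp|/imp //]; rewrite turnK.
Qed.

Lemma centrally_symmetricP D :
  (forall d, d \in D -> turn d \in D) -> centrally_symmetric D.
Proof.
move=> imp; rewrite /centrally_symmetric eqEsubset; apply/andP; split.
  by apply/subsetP => _ /imsetP[d dD ->]; apply: imp.
apply/subsetP => d dD; apply/imsetP; exists (turn d); first exact: imp.
by rewrite -/(turn _) turnK.
Qed.

(** [turn d] crosses [e] exactly when [d] crosses [turn e], and [d] does not cross its own image. *)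
Lemma noncrossing_orbit D d : noncrossing_diagonals D -> centrally_symmetric D ->
  diagonal d -> {in D, forall e, ~~ crossing d e} ->
  noncrossing_diagonals (d |: (turn d |: D)) /\
  centrally_symmetric (d |: (turn d |: D)).
Proof.
move=> ncD csD dd dn; have [dD _] := noncrossingP _ ncD; split.
  apply: noncrossingU1 => //.
    apply: noncrossingU1 => [//||e eD]; first by rewrite diagonal_turn.
    rewrite -[e]turnK crossing_turn ?diagonal_turn; [|by []|exact: dD].
    by rewrite dn // turn_centrally_symmetric.
  by move=> e /setU1P[->|/dn//]; apply: crossing_turn_self.
apply: centrally_symmetricP => e; rewrite !inE => /or3P[/eqP->|/eqP->|eD].
- by rewrite eqxx orbT.
- by rewrite turnK eqxx.
- by rewrite (turn_centrally_symmetric _ csD) eD !orbT.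
Qed.

Hypothesis n0 : 0 < n.
Let N3 : 2 < N. Proof. by lia. Qed.

(** A maximal symmetric noncrossing set is maximal among all noncrossing sets: a diagonal that could
    be added could be added together with its image. *)
Lemma cs_extend D : noncrossing_diagonals D -> centrally_symmetric D ->
  exists T, cs_triangulation T /\ D \subset T.
Proof.
move=> ncD csD; pose P D := noncrossing_diagonals D && centrally_symmetric D.
have PD : P D by rewrite /P ncD.
have [T /maxsetP[/andP[ncT csT] maxT] DT] := maxset_exists PD.
exists T; split=> //; rewrite /cs_triangulation csT andbT.
apply: maximal_triangulation => //; apply: maximal_noncrossing_edge => // d dd dn.
have [ncT' csT'] := noncrossing_orbit ncT csT dd dn.
rewrite -(maxT (d |: (turn d |: T))); first by rewrite setU11.
  by rewrite /P ncT' csT'.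
by rewrite setUA subsetUr.
Qed.

(** The other diagonal [d'] of the quadrilateral around [d] crosses no other member of [T], so the
    orbit of [d] can be replaced by that of [d']. Completing the result by [cs_extend] treats
    diameters and pairs alike. *)
Lemma cs_flip T d : cs_triangulation T -> d \in T ->
  exists T', [/\ cs_triangulation T', d \notin T' &
    forall e, e \in T -> e != d -> e != turn d -> e \in T'].
Proof.
case/andP => triT csT dT; have [ncT _] := andP triT.
have [dD nT] := noncrossingP _ ncT.
have [u [v [dE uv nb]]] := diagonal_set2 (dD _ dT).
have nuv : u != v by rewrite -val_eqE /= ltn_eqF.
have mT := triangulation_maximal N3 triT.
have euv : edge T u v by rewrite /edge -dE dT.
have evu : edge T v u by rewrite (mnc_sym mT).
have [|z [cz uz zv]] := side_triangle mT euv (x := ordS u).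
  exact: diagonal_cyc.
have [|y [cy vy yu]] := side_triangle mT evu (x := ordS v).
  by apply: diagonal_cyc; rewrite 1?eq_sym // setUC.
pose d' := [set z; y]; pose D := T :\ d :\ turn d.
have DT e : e \in D -> [/\ e \in T, e != d & e != turn d].
  by rewrite !inE => /and3P[-> -> ->].
have cr : crosses u v z y := quad_crosses cz cy.
have dd' : diagonal d' by apply: (@crosses_diagonal _ _ _ u v); rewrite crosses_sym.
have ncD : noncrossing_diagonals D.
  apply/noncrossingP; split; first by move=> e /DT[/dD].
  by move=> e f /DT[? _ _] /DT[? _ _]; apply: nT.
have csD : centrally_symmetric D.
  apply: centrally_symmetricP => e /DT[eT ed etd].
  rewrite !inE (inj_eq (can_inj turnK)) ed (turn_centrally_symmetric _ csT) eT.
  by rewrite andbT -(inj_eq (can_inj turnK)) turnK etd.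
have nD : {in D, forall e, ~~ crossing d' e}.
  move=> e /DT[eT ed _]; apply: (flip_noncrossing N3 triT cz cy) => //.
  by rewrite -dE.
have [ncD' csD'] := noncrossing_orbit ncD csD dd' nD.
have [T' [csT' sub]] := cs_extend ncD' csD'.
exists T'; split=> //; last first.
  move=> e eT ed etd; apply: (subsetP sub).
  by rewrite !inE ed etd eT !orbT.
apply/negP => dT'; have [/andP[/andP[ncT' _] _]] := csT'.
have [_ nT'] := noncrossingP _ ncT'.
have d'T' : d' \in T' by apply: (subsetP sub); rewrite setU11.
by have := nT' _ _ dT' d'T'; rewrite dE crossing_cyc cr.
Qed.

(** [T] has [2n - 1] diagonals. A diagonal fixed by the half-turn is a diameter, and two diameters
    cross; by parity there is one diameter and there are [n - 1] pairs. *)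
Lemma orbit_representatives T : cs_triangulation T ->
  exists r : seq {set 'I_N}, [/\ uniq r, size r = n, {subset r <= T},
    forall d, d \in T -> d \in r \/ turn d \in r &
    forall d e, d \in r -> e \in r -> e = turn d -> e = d].
Proof.
case/andP => triT csT; have [ncT /eqP cT] := andP triT.
have [dT nT] := noncrossingP _ ncT.
pose R := [set d in T | enum_rank d <= enum_rank (turn d)].
have RT d : d \in R -> d \in T by rewrite inE => /andP[].
have total d : d \in T -> d \in R \/ turn d \in R.
  move=> dD; rewrite !inE (turn_centrally_symmetric _ csT) dD turnK /=.
  by apply/orP; exact: leq_total.
have anti d e : d \in R -> e \in R -> e = turn d -> e = d.
  move=> dR eR ed; move: dR eR; rewrite ed !inE turnK => /andP[_ h1] /andP[_ h2].
  by apply: enum_rank_inj; apply: ord_inj; apply/eqP; rewrite eqn_leq h1 h2.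
exists (enum R); split.
- exact: enum_uniq.
- rewrite -cardE.
  have TU : T = R :|: turn @: R.
    apply/setP => d; apply/idP/setUP => [dD|[/RT //|/imsetP[e /RT eT ->]]].
      case: (total d dD) => dR; [by left|right].
      by apply/imsetP; exists (turn d); rewrite ?turnK.
    by rewrite turn_centrally_symmetric.
  have cI : #|R :&: turn @: R| <= 1.
    apply/card_le1P => d /setIP[dR /imsetP[e eR de]].
    have fix_d : turn d = d by rewrite [in LHS](anti e d eR dR de) -de.
    move=> f; rewrite inE [f \in pred1 _]inE.
    apply/andP/eqP => [[fR /imsetP[g gR fg]]|->]; last first.
      by split=> //; apply/imsetP; exists d.
    have fix_f : turn f = f by rewrite [in LHS](anti g f gR fR fg) -fg.
    have [u [v [dE uv _]]] := diagonal_set2 (dT _ (RT _ dR)).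
    have [x [y [fE xy _]]] := diagonal_set2 (dT _ (RT _ fR)).
    have := nT _ _ (RT _ dR) (RT _ fR).
    rewrite dE fE crossing_cyc => ncr.
    move/eqP: fix_d; rewrite dE turn_set2 => /set2_eqP H1.
    move/eqP: fix_f; rewrite fE turn_set2 => /set2_eqP H2.
    have hu : h u = v :> nat.
      case: H1 => [][e1 e2]; last by rewrite e1.
      by have := half_turnP u; rewrite e1; clear; lia.
    have hx : h x = y :> nat.
      case: H2 => [][e1 e2]; last by rewrite e1.
      by have := half_turnP x; rewrite e1; clear; lia.
    suff ux : u = x :> nat.
      have vy : v = y :> nat by rewrite -hu -hx (ord_inj ux).
      by rewrite (ord_inj ux) (ord_inj vy).
    move: ncr; have := half_turnP u; have := half_turnP x; rewrite hu hx /crosses.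
    have := ltn_ord v; have := ltn_ord y; move: uv xy; clear; cyc_lia.
  move: cI (cardsUI R (turn @: R)).
  rewrite -TU cT (card_imset _ (can_inj turnK)).
  by move: #|_ :&: _| #|R| n0 => i r; clear; lia.
- by move=> d; rewrite mem_enum; apply: RT.
- by move=> d /total; rewrite !mem_enum.
- by move=> d e; rewrite !mem_enum; apply: anti.
Qed.

End HalfTurn.

(** * The labelling of the polygon *)

Section Labels.
Variables (n : nat) (A : orientation n).
Local Notation m := (2 * n).
Local Notation N := (2 * n).+2.
Local Notation lam := (@label n A).
Local Notation cd := (@ccw_dist N).
Implicit Types (u v w x y z a b : 'I_N) (T : {set {set 'I_N}}).

Definition down_vertex v : bool := ~~ up A (lam v).

Lemma labelsE : labels A =
  [seq i <- iota 0 N | ~~ up A i] ++ rev [seq i <- iota 0 N | up A i].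
Proof.
have -> : iota 0 N = 0 :: rcons (iota 1 m) m.+1.
  by rewrite -[iota 0 N]/(0 :: iota 1 m.+1) -[in LHS](addn1 m) iotaD cats1 add1n.
have upN : up A m.+1 = false by rewrite /up; lia.
by rewrite /labels /= !filter_rcons upN /= cat_rcons.
Qed.

Lemma perm_labels : perm_eq (labels A) (iota 0 N).
Proof.
rewrite perm_sym -(perm_filterC (up A) (iota 0 N)) perm_sym labelsE.
by rewrite perm_catC perm_cat2r perm_rev.
Qed.

Lemma size_labels : size (labels A) = N.
Proof. by rewrite (perm_size perm_labels) size_iota. Qed.

Lemma uniq_labels : uniq (labels A).
Proof. by rewrite (perm_uniq perm_labels) iota_uniq. Qed.

Lemma label_lt v : lam v < N.
Proof.
have : lam v \in labels A by rewrite mem_nth // size_labels.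
by rewrite (perm_mem perm_labels) mem_iota.
Qed.

Lemma vertexK i : i < N -> lam (vertex A i) = i.
Proof.
move=> iN; have iL : i \in labels A by rewrite (perm_mem perm_labels) mem_iota.
by rewrite /label /vertex inordK ?nth_index // -size_labels index_mem.
Qed.

Lemma labelK v : vertex A (lam v) = v.
Proof.
apply: ord_inj; rewrite /vertex /label index_uniq ?uniq_labels ?size_labels //.
by rewrite inordK.
Qed.

(** Along the polygon the labels increase through the down vertices and then decrease through the up
    ones. The run that contains the middle label decides the orientation of a triple. *)
Lemma label_labelling : labelling lam down_vertex.
Proof.
split=> [|u v w]; first exact: can_inj labelK.
pose s := [seq i <- iota 0 N | ~~ up A i].
pose t := rev [seq i <- iota 0 N | up A i].
have sort_s : sorted ltn s by apply: (sorted_filter ltn_trans); exact: iota_ltn_sorted.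
have sort_t : sorted gtn t.
  rewrite rev_sorted; apply: (sorted_filter (leT := ltn) ltn_trans).
  exact: iota_ltn_sorted.
have labE x : lam x = if x < size s then nth 0 s x else nth 0 t (x - size s).
  by rewrite /label labelsE nth_cat.
have sz : size s + size t = N by rewrite -size_cat -labelsE size_labels.
have lt_s x y : x < y -> y < size s -> lam x < lam y.
  move=> xy ys; rewrite !labE ys (ltn_trans xy ys).
  by apply: (sorted_ltn_nth ltn_trans) => //; rewrite inE // (ltn_trans xy).
have gt_t x y : x < y -> size s <= x -> lam y < lam x.
  move=> xy xs; have ys := leq_trans xs (ltnW xy).
  have labE_t z : size s <= z -> lam z = nth 0 t (z - size s).
    by rewrite labE ltnNge => ->.
  rewrite !labE_t //.
  have trans : transitive gtn by move=> ? ? ? /[swap]; exact: ltn_trans.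
  apply: (sorted_ltn_nth trans) => //; rewrite ?inE.
  - by have := ltn_ord x; move: sz xs; clear; lia.
  - by have := ltn_ord y; move: sz ys; clear; lia.
  - by move: xy xs; clear; lia.
have down_vertexE x : down_vertex x = (x < size s).
  rewrite /down_vertex labE; case: ltnP => xs.
    have := mem_nth 0 xs; rewrite mem_filter => /andP[-> //].
  have : x - size s < size t by have := ltn_ord x; move: sz xs; clear; lia.
  by move=> /(mem_nth 0); rewrite mem_rev mem_filter => /andP[->].
rewrite down_vertexE => uv vw.
have neq x y : lam x < lam y -> x != y :> nat.
  by move=> xy; apply: contraTneq xy => /ord_inj ->; rewrite ltnn.
have := neq _ _ uv; have := neq _ _ vw; have := neq _ _ (ltn_trans uv vw).
have := lt_s u v; have := lt_s v u; have := lt_s v w; have := lt_s w v.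
have := lt_s u w; have := lt_s w u.
have := gt_t u v; have := gt_t v u; have := gt_t v w; have := gt_t w v.
have := gt_t u w; have := gt_t w u.
move: uv vw; move: (lam u) (lam v) (lam w) (size s) => x y z k.
clear; case: (ltnP v k); unfold cyc; lia.
Qed.

Lemma mem_ccw_path v u x : (x \in ccw_path v u) = (cd v x <= cd v u).
Proof.
have it k : iter k (@ordS N) v = (v + k) %% N :> nat.
  elim: k => [|k IH] /=; first by rewrite addn0 modn_small.
  by rewrite IH -addn1 modnDml addn1 addnS.
apply/mapP/idP => [[k]|le].
  rewrite mem_iota add0n /= ltnS => kd ->.
  have kN : k < N := leq_ltn_trans kd (cd_lt v u).
  suff -> : cd v (iter k (@ordS N) v) = k by [].
  rewrite /ccw_dist it -addnBA; last exact: ltnW (ltn_ord v).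
  rewrite modnDml.
  have -> : v + k + (N - v) = k + N by have := ltn_ord v; clear; lia.
  by rewrite modnDr modn_small.
exists (cd v x); first by rewrite mem_iota.
apply: ord_inj; rewrite it; have := cdP v x; have := ltn_ord x.
by move=> xN [e|[_ e]]; rewrite addnC e ?modnDr modn_small.
Qed.

(** The allowed arc contains only labels on the same side of [v] as [u]. Since [v] is inner, there
    is a label on the other side, and it witnesses that the other arc is not allowed. *)
Lemma muE v u : inner lam v -> u != v ->
  mu A (lam v) (lam u) = if (lam u < lam v) == down_vertex v then cd u v else cd v u.
Proof.
case/andP => /existsP[l lv] /existsP[r vr] uv.
have lab := label_labelling.
have nuv : u != v :> nat by [].
have nl : lam u != lam v by rewrite -(lab_neq lab).
rewrite /mu !labelK.
suff -> : all (mu_allowed (lam v) (lam u)) (map lam (ccw_path v u)) =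
  ((lam u < lam v) != down_vertex v) by case: eqP.
have dist x : x \in ccw_path v u -> [|| x == v :> nat, x == u :> nat | cyc v x u].
  rewrite mem_ccw_path => le.
  case: (eqVneq (x : nat) v) => //= xv; case: (eqVneq (x : nat) u) => //= xu.
  rewrite cd_ltP 1?eq_sym // ltn_neqAle le andbT.
  have := cdP v x; have := cdP v u; have := ltn_ord x; have := ltn_ord u.
  by move: xu; clear; lia.
have path x : cyc v x u -> x \in ccw_path v u.
  by rewrite mem_ccw_path => c; rewrite ltnW // -cd_ltP //; move: c; clear; unfold cyc; lia.
rewrite all_map; case: (ltnP (lam u) (lam v)) => luv.
- have allE x : mu_allowed (lam v) (lam u) (lam x) = (lam x <= lam v).
    by rewrite /mu_allowed luv.
  case dv: (down_vertex v).
    apply/negbTE/allPn; exists r; last by rewrite /= allE -ltnNge.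
    apply: path.
    by have := lab_cyc lab luv vr; rewrite dv cyc_rot.
  apply/allP => x /dist/or3P[/eqP/ord_inj->|/eqP/ord_inj->|c] /=; rewrite allE //.
    exact: ltnW.
  rewrite leqNgt; apply/negP => vx; have := lab_cyc lab luv vx.
  by rewrite dv cyc_rot c.
- have vu : lam v < lam u by rewrite ltn_neqAle eq_sym nl.
  have allE x : mu_allowed (lam v) (lam u) (lam x) = (lam v <= lam x).
    by rewrite /mu_allowed ltnNge luv.
  case dv: (down_vertex v).
    apply/allP => x /dist/or3P[/eqP/ord_inj->|/eqP/ord_inj->|c] /=; rewrite allE //.
    rewrite leqNgt; apply/negP => xv; have := lab_cyc lab xv vu.
    by rewrite dv; move: c; clear; unfold cyc; lia.
  apply/negbTE/allPn; exists l; last by rewrite /= allE -ltnNge.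
  apply: path.
  have := lab_cyc lab lv vu; rewrite dv.
  have : l != v :> nat by rewrite (lab_neq lab) ltn_eqF.
  have : l != u :> nat by rewrite (lab_neq lab) ltn_eqF // (ltn_trans lv).
  by move: nuv; clear; unfold cyc; lia.
Qed.

Hypothesis n0 : 0 < n.
Let N3 : 2 < N. Proof. by lia. Qed.

(** The maxima in [p_left] and [p_right] are attained at [a] and [b]: an edge from [v] to a farther
    neighbour would cross [ab]. *)
Lemma weight_mid T : triangulation T ->
  mid_weight lam down_vertex (edge T) (fun v => weight A T (lam v)).
Proof.
move=> triT a v b av vb eav evb eab.
have lab := label_labelling; have mT := triangulation_maximal N3 triT.
have symT := mnc_sym mT.
have inv : inner lam v by apply/andP; split; apply/existsP; [exists a|exists b].
have cabv := lab_cyc lab av vb.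
have neq x : lam x != lam v -> x != v by apply: contraNneq => ->.
have teE x y : tri_edge A T (lam x) (lam y) = edge T x y.
  by rewrite /tri_edge !labelK.
have nav : a != v :> nat by rewrite (lab_neq lab) ltn_eqF.
have nvb : v != b :> nat by rewrite (lab_neq lab) ltn_eqF.
have nab : a != b :> nat by rewrite (lab_neq lab) ltn_eqF // (ltn_trans av).
have left : p_left A T (lam v) = mu A (lam v) (lam a).
  apply/eqP; rewrite /p_left eqn_leq; apply/andP; split; last first.
    by apply: (bigmaxn_sup_seq (lam a)); rewrite ?mem_index_iota ?teE.
  apply/bigop.bigmax_leqP_seq => i; rewrite mem_index_iota /= => iv.
  have iN := ltn_trans iv (label_lt v).
  rewrite -(vertexK iN) in iv *; move: (vertex A i) iv => x xv.
  rewrite teE !muE ?neq ?ltn_eqF // xv av => exv.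
  have nxv : x != v :> nat by rewrite (lab_neq lab) ltn_eqF.
  have cxbv := lab_cyc lab xv vb.
  have nxb : x != b :> nat by rewrite (lab_neq lab) ltn_eqF // (ltn_trans xv).
  rewrite leqNgt; apply/negP => lt.
  case dv: (down_vertex v) lt cabv cxbv => /= lt cabv cxbv.
    have c : cyc v x a.
      rewrite cd_ltP 1?eq_sym //; have := cdC nav; have := cdC nxv.
      by move: lt; clear; lia.
    have eba : edge T b a by rewrite symT.
    apply: (mnc_noncrossing mT eba exv _ cabv).
    by move: c cabv cxbv; clear; unfold cyc; lia.
  have c : cyc v a x by rewrite cd_ltP // eq_sym.
  apply: (mnc_noncrossing mT eab exv).
    by move: c cabv cxbv nav nvb nab nxv nxb; clear; unfold cyc; lia.
  by move: c cabv cxbv nav nvb nab nxv nxb; clear; unfold cyc; lia.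
have right : p_right A T (lam v) = mu A (lam v) (lam b).
  apply/eqP; rewrite /p_right eqn_leq; apply/andP; split; last first.
    apply: (bigmaxn_sup_seq (lam b)); rewrite ?mem_index_iota ?teE //.
    by rewrite vb label_lt.
  apply/bigop.bigmax_leqP_seq => i; rewrite mem_index_iota => /andP[vi iN].
  rewrite -(vertexK iN) in vi *; move: (vertex A i) vi => x vx.
  rewrite teE !muE ?neq ?gtn_eqF // !ltnNge (ltnW vx) (ltnW vb) /= => evx.
  have nxv : x != v :> nat by rewrite (lab_neq lab) gtn_eqF.
  have cxbv := lab_cyc lab av vx.
  have nxa : x != a :> nat by rewrite (lab_neq lab) gtn_eqF // (ltn_trans av).
  rewrite leqNgt; apply/negP => lt.
  have exv : edge T x v by rewrite symT.
  case dv: (down_vertex v) lt cabv cxbv => /= lt cabv cxbv.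
    have c : cyc v b x by rewrite cd_ltP // eq_sym.
    have eba : edge T b a by rewrite symT.
    apply: (mnc_noncrossing mT eba exv _ cabv).
    by move: c cabv cxbv; clear; unfold cyc; lia.
  have c : cyc v x b.
    have nvx : v != x :> nat by rewrite eq_sym.
    rewrite cd_ltP //; have := cdC nvb; have := cdC nxv.
    by move: lt; clear; lia.
  apply: (mnc_noncrossing mT eab exv).
    by move: c cabv cxbv nav nvb nab nxv nxa; clear; unfold cyc; lia.
  by move: c cabv cxbv nav nvb nab nxv nxa; clear; unfold cyc; lia.
have nav' : a != v by [].
have nbv : b != v by apply: neq; rewrite gtn_eqF.
rewrite /weight left right !muE //.
rewrite av ltnNge (ltnW vb) /= /tri_weight.
by case: (down_vertex v).
Qed.

End Labels.

(** * Symmetric orientations and the half-turn *)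

Section SymmetricLabels.
Variables (n : nat) (A : orientation n).
Hypotheses (n0 : 0 < n) (symA : symmetric_orientation A).
Local Notation m := (2 * n).
Local Notation N := (2 * n).+2.
Local Notation lam := (@label n A).
Local Notation cd := (@ccw_dist N).
Local Notation h := (@half_turn n).
Implicit Types (u v w x y z a b : 'I_N) (T : {set {set 'I_N}}).

Lemma arrow_neg i : 0 < i -> i < m - 1 -> arrow A i.+1 i = ~~ arrow A i i.+1.
Proof.
case: i => // i _ im; have im' : i < 2 * n - 2 by lia.
pose e := Ordinal im'.
have arE (b : bool) : arrow A (if b then i.+1 else i.+2) (if b then i.+2 else i.+1) =
    (A e == b).
  apply/existsP/eqP => [[f /eqP]|eb]; last first.
    by exists e; rewrite eb; case: (b).
  by case Af: (A f); case: b => -[h1 h2]; try (exfalso; clear -h1 h2; lia);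
    rewrite -Af; congr (A _); apply: ord_inj; rewrite /= ?h1 //; clear -h1; lia.
by rewrite (arE false) (arE true); case: (A e).
Qed.

(** Symmetry identifies the arrow from [m + 1 - i] to [m - i] with the one from [i - 1] to [i], the
    reverse of the arrow that makes [i] up. *)
Lemma up_turn i : 1 < i -> i < m -> up A (m.+1 - i) = ~~ up A i.
Proof.
move=> i1 im; rewrite /up.
have -> : (1 < m.+1 - i) by lia.
have -> : (m.+1 - i <= m - 1) by lia.
have -> : i <= m - 1 by lia.
have -> : (m.+1 - i).-1 = m - i by lia.
rewrite i1 /=; have [j ji] : exists j, i = j.+1 by exists i.-1; lia.
have jm : 1 <= j <= m - 2 by lia.
rewrite ji subSS -[j.+1.-1]/j arrow_neg ?negbK; try lia.
by rewrite (symA jm); congr (arrow A _ _); lia.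
Qed.

Let mids := [seq i <- iota 2 (m - 2) | ~~ up A i].

(** The up labels are the reflections of the down labels strictly between [1] and [m], and
    reflecting the increasing list gives the decreasing one. So the two halves match position by
    position. *)
Lemma labels_symmetric :
  labels A = ([:: 0; 1] ++ mids) ++ [:: m; m.+1] ++ [seq m.+1 - i | i <- mids].
Proof.
have iE : iota 0 N = [:: 0; 1] ++ iota 2 (m - 2) ++ [:: m; m.+1].
  have -> : N = 2 + (m - 2 + 2) by lia.
  by rewrite !iotaD /=; congr [:: _, _ & _ ++ [:: _; _]]; lia.
have [u0 u1 um uN] : [/\ up A 0 = false, up A 1 = false, up A m = false &
    up A m.+1 = false].
  by split=> //; rewrite /up; lia.
rewrite labelsE iE !filter_cat /= ?u0 ?u1 um uN /= ?cats0 -catA.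
congr [:: _, _ & _ ++ [:: _, _ & _]].
rewrite -filter_rev.
have -> : rev (iota 2 (m - 2)) = [seq m.+1 - i | i <- iota 2 (m - 2)].
  apply: (@eq_from_nth _ 0); rewrite size_rev ?size_map // => i.
  rewrite size_iota => im.
  rewrite nth_rev ?size_iota // (nth_map 0) ?size_iota // !nth_iota; lia.
rewrite filter_map; congr map; apply: eq_in_filter => i.
by rewrite mem_iota /= => /andP[i1 im]; apply: up_turn; lia.
Qed.

Lemma size_mids : size mids = n.-1.
Proof.
have := size_labels A; rewrite labels_symmetric !size_cat size_map /=.
move: (size mids) => s; clear -n0; lia.
Qed.

(* The half-turn maps label i to m+1-i, except that it exchanges 0 with m and 1
   with m+1. *)
Definition opposite l l' : bool :=
  [|| (l == 0) && (l' == m), (l == 1) && (l' == m.+1), (l == m) && (l' == 0),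
      (l == m.+1) && (l' == 1) | (1 < l < m) && (l' == m.+1 - l)].

Lemma label_half_turn u : opposite (lam u) (lam (h u)).
Proof.
have key v w : v < n.+1 -> w = v + n.+1 :> nat -> opposite (lam v) (lam w).
  move=> vn wE; rewrite /label labels_symmetric wE.
  have s1 : size ([:: 0; 1] ++ mids) = n.+1.
    by rewrite size_cat size_mids /=; lia.
  move: s1; set L := _ ++ mids; set R := _ ++ map _ _ => s1.
  have wn : (v + n.+1 < n.+1) = false by lia.
  rewrite !nth_cat s1 vn wn addnK /L /R {L R s1 wE}.
  move: vn; case: (nat_of_ord v) => [|[|k]] kn; rewrite /opposite ?eqxx ?orbT //=.
  have ks : k < size mids by rewrite size_mids; lia.
  rewrite !subSS subn0 (nth_map 0) // eqxx andbT.
  have := mem_nth 0 ks; rewrite mem_filter mem_iota => /andP[_ /andP[-> lt]].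
  move: (nth 0 mids k) lt => q lt; clear -n0 lt; lia.
have oppC l l' : opposite l l' -> opposite l' l by rewrite /opposite; lia.
case: (half_turnP u) => -[h1 h2]; first exact: key.
by apply/oppC/key; [have := ltn_ord u; lia|].
Qed.

Lemma label_half_turn_mid u : 1 < lam u -> lam u < m -> lam (h u) = m.+1 - lam u.
Proof. by have := label_half_turn u; rewrite /opposite; lia. Qed.

(** The exceptional labels [0], [1] and [m], [m + 1] still change sides, so comparisons with a label
    strictly between [1] and [m] are reversed. *)
Lemma label_half_turn_gt v x : 1 < lam v -> lam v < m ->
  (lam x < lam v -> lam (h v) < lam (h x)) /\
  (lam v < lam x -> lam (h x) < lam (h v)).
Proof.
move=> v1 vm; rewrite label_half_turn_mid //.
by have := label_half_turn x; have := label_lt A x; rewrite /opposite; lia.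
Qed.

Lemma edge_half_turn T u v : cs_triangulation T ->
  edge T (h u) (h v) = edge T u v.
Proof.
by case/andP => _ csT; rewrite /edge -turn_set2 turn_centrally_symmetric //
  boundary_turn.
Qed.

Lemma cd_half_turn u v : cd (h u) (h v) = cd u v.
Proof.
have := half_turnP u; have := half_turnP v.
have := cdP (h u) (h v); have := cdP u v.
have := cd_lt (h u) (h v); have := cd_lt u v.
have := ltn_ord (h u); have := ltn_ord (h v); have := ltn_ord u; have := ltn_ord v.
clear; lia.
Qed.

Let N3 : 2 < N. Proof. by lia. Qed.

(** The half-turn carries the middle triangle of [l] to that of [m + 1 - l], preserving arc lengths.
    It exchanges the left and right sides, and the change between down and up compensates for
    this. *)
Lemma weight_half_turn T l : cs_triangulation T -> 1 < l -> l < m ->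
  weight A T (m.+1 - l) = weight A T l.
Proof.
move=> csT l1 lm; have [triT _] := andP csT.
have lN : l < N by lia.
pose v := vertex A l; have vl : lam v = l by apply: vertexK.
have v0 : lam (vertex A 0) < lam v by rewrite vl vertexK //; lia.
have vm : lam v < lam (vertex A m.+1) by rewrite vl vertexK //; lia.
have lab := label_labelling A; have mT := triangulation_maximal N3 triT.
have [a [b [av vb e1 e2 e3]]] := mid_triangle lab mT v0 vm.
have wT := weight_mid n0 triT (A := A).
have [l1' lm'] : 1 < lam v /\ lam v < m by rewrite vl.
have [gt1 _] := label_half_turn_gt a l1' lm'.
have [_ gt2] := label_half_turn_gt b l1' lm'.
have e1' : edge T (h v) (h a) by rewrite edge_half_turn // edge_sym.
have e2' : edge T (h b) (h v) by rewrite edge_half_turn // edge_sym.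
have e3' : edge T (h b) (h a) by rewrite edge_half_turn // edge_sym.
have := wT _ _ _ (gt2 vb) (gt1 av) e2' e1' e3'.
rewrite label_half_turn_mid // vl => ->.
have := wT _ _ _ av vb e1 e2 e3; rewrite vl => ->.
rewrite /tri_weight !cd_half_turn.
have -> : down_vertex A (h v) = ~~ down_vertex A v.
  by rewrite /down_vertex label_half_turn_mid // vl up_turn.
by case: (down_vertex A v); rewrite /= mulnC.
Qed.

(** Labels [1] and [m] are both down, so here the weights themselves must add up. The half-turn maps
    the triangle [0], [1], [b] to the middle triangle of [m]. As [0] and [1] are adjacent, the two
    weights are the arcs from [1] to [b] and from [b] to [0], which together miss one of the [m + 2]
    boundary edges. *)
Lemma weight_ends T : cs_triangulation T -> weight A T 1 + weight A T m = m.+1.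
Proof.
move=> csT; have [triT _] := andP csT.
have lab := label_labelling A; have mT := triangulation_maximal N3 triT.
pose v := vertex A 1; have vl : lam v = 1 by apply: vertexK.
have v0 : lam (vertex A 0) < lam v by rewrite vl vertexK.
have vm : lam v < lam (vertex A m.+1) by rewrite vl vertexK //; lia.
have [a [b [av vb e1 e2 e3]]] := mid_triangle lab mT v0 vm.
have wT := weight_mid n0 triT (A := A).
have al : lam a = 0 by rewrite vl in av; lia.
have dv : down_vertex A v by rewrite /down_vertex vl.
have hv : lam (h v) = m.+1.
  by have := label_half_turn v; rewrite /opposite vl; lia.
have ha : lam (h a) = m.
  by have := label_half_turn a; rewrite /opposite al; lia.
have hb : lam (h b) < m.
  have := label_half_turn b; rewrite /opposite; rewrite vl in vb.
  by have := label_lt A b; lia.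
have dm : down_vertex A (h a) by rewrite /down_vertex ha /up; lia.
have lt1 : lam (h b) < lam (h a) by rewrite ha.
have lt2 : lam (h a) < lam (h v) by rewrite ha hv.
have e1' : edge T (h a) (h v) by rewrite edge_half_turn.
have e2' : edge T (h b) (h v) by rewrite edge_half_turn // edge_sym.
have e3' : edge T (h b) (h a) by rewrite edge_half_turn // edge_sym.
have := wT _ _ _ lt1 lt2 e3' e1' e2'.
have := wT _ _ _ av vb e1 e2 e3.
rewrite /tri_weight dv dm ha vl !cd_half_turn => -> ->.
have c := lab_cyc lab av vb; rewrite dv in c.
(* A vertex between those labelled [0] and [1] would have a larger label, against label [1] being
   down. *)
have av1 : cd a v = 1.
  have nx x : cyc a x v = false.
    apply/negbTE/negP => cx; have vx : lam v < lam x.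
      have : x != a :> nat by move: cx; clear; unfold cyc; lia.
      have : x != v :> nat by move: cx; clear; unfold cyc; lia.
      by rewrite !(lab_neq lab) vl al; clear; lia.
    by have := lab_cyc lab av vx; rewrite dv; move: cx; clear; unfold cyc; lia.
  have := nx (ordS a); have := ordS_neq N3 a; have := val_ordS a.
  have nav : a != v :> nat by rewrite (lab_neq lab) ltn_eqF.
  have := cdP a v; have := ltn_ord v; have := ltn_ord a; have := cd_lt a v.
  case: (a.+1 =P N) => aN; move: nav aN; move: (nat_of_ord (ordS a)) => s;
    clear; unfold cyc; lia.
have nab : a != b :> nat by move: c; clear; unfold cyc; lia.
have := cdD c; have := cdC nab; rewrite av1; clear; lia.
Qed.

End SymmetricLabels.

From mathcomp Require Import interval_inference.
From mathcomp Require Import boolp classical_sets reals convex.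
Local Open Scope classical_set_scope.
Local Open Scope ring_scope.

(** * Convexity *)

Section Hull.
Variables (R : realType) (m : nat).
Local Notation V := 'rV[R]_m.
Implicit Types (X : set V) (x y p : V) (c : 'cV[R]_m).

Lemma hull_sub X (P : set V) : X `<=` P ->
    (forall x y (t : R), 0 <= t <= 1 -> P x -> P y -> P (t *: x + (1 - t) *: y)) ->
  convex_hull X `<=` P.
Proof.
move=> XP cP; apply: smallest_sub => // x y t; rewrite !inE => Px Py.
by apply: (cP x y t%:num) => //; rewrite ge0 le1.
Qed.

Lemma sub_hull X : X `<=` convex_hull X.
Proof. exact: sub_gen_smallest. Qed.

Definition ev c x : R := (x *m c) 0 0.

Lemma evD c x y : ev c (x + y) = ev c x + ev c y.
Proof. by rewrite /ev mulmxDl mxE. Qed.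

Lemma evZ c t x : ev c (t *: x) = t * ev c x.
Proof. by rewrite /ev -scalemxAl mxE. Qed.

Lemma evB c x y : ev c (x - y) = ev c x - ev c y.
Proof. by rewrite evD -scaleN1r evZ mulN1r. Qed.

Lemma ev_sum c (I : Type) (r : seq I) (P : pred I) (F : I -> V) :
  ev c (\sum_(i <- r | P i) F i) = \sum_(i <- r | P i) ev c (F i).
Proof. by rewrite /ev mulmx_suml summxE. Qed.

Lemma hull_ev_ge X c (b : R) : (forall x, X x -> b <= ev c x) ->
  forall x, convex_hull X x -> b <= ev c x.
Proof.
move=> H; apply: hull_sub => // x y t /andP[t0 t1] /= bx by_.
rewrite evD !evZ.
have t1' : 0 <= 1 - t by rewrite subr_ge0.
have -> : b = t * b + (1 - t) * b by ring.
by rewrite lerD // ler_wpM2l.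
Qed.

Lemma hull_ev_le X c (b : R) : (forall x, X x -> ev c x <= b) ->
  forall x, convex_hull X x -> ev c x <= b.
Proof.
move=> H; apply: hull_sub => // x y t /andP[t0 t1] /= bx by_.
rewrite evD !evZ.
have t1' : 0 <= 1 - t by rewrite subr_ge0.
have -> : b = t * b + (1 - t) * b by ring.
by rewrite lerD // ler_wpM2l.
Qed.

Lemma hull_sub_vspace X p (U : {vspace V}) : (forall x, X x -> x - p \in U) ->
  forall x, convex_hull X x -> x - p \in U.
Proof.
move=> H; apply: hull_sub => // x y t _ /= xU yU.
have -> : t *: x + (1 - t) *: y - p = t *: (x - p) + (1 - t) *: (y - p).
  rewrite !scalerBr addrACA -opprD -scalerDl addrCA subrr addr0 scale1r.
  by rewrite [t *: x + _]addrC.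
by rewrite memvD // memvZ.
Qed.

End Hull.

(** * The linear space containing the differences of vertices *)

Section AntisymmetricVectors.
Variables (R : realType) (n : nat).
Local Notation m := (2 * n)%N.
Local Notation V := 'rV[R]_m.

Definition reversal_sum : 'M[R]_m :=
  \matrix_(i, j) ((i == j)%:R + (i == rev_ord j)%:R).

Lemma reversal_sumE (x : V) k :
  (x *m reversal_sum) 0 k = x 0 k + x 0 (rev_ord k).
Proof.
rewrite mxE; under eq_bigr => j _ do rewrite mxE mulrDr.
rewrite big_split /=; congr (_ + _).
  rewrite (bigD1 k) //= eqxx mulr1 big1 ?addr0 // => j /negbTE->.
  by rewrite mulr0.
rewrite (bigD1 (rev_ord k)) //= eqxx mulr1 big1 ?addr0 // => j /negbTE->.
by rewrite mulr0.
Qed.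

Definition antisymmetric_space : {vspace V} :=
  lker (linfun (mulmxr reversal_sum)).

Lemma antisymmetricP (x : V) :
  reflect (forall k, x 0 k + x 0 (rev_ord k) = 0) (x \in antisymmetric_space).
Proof.
rewrite memv_ker lfunE /=; apply: (iffP eqP) => [e k|H].
  by rewrite -reversal_sumE e mxE.
by apply/rowP => k; rewrite reversal_sumE H mxE.
Qed.

(** The first [n] coordinates determine an antisymmetric vector. *)
Lemma dim_antisymmetric : (\dim antisymmetric_space <= n)%N.
Proof.
have le : (n <= m)%N by lia.
pose Q : 'M[R]_(m, n) := \matrix_(i, j) (i == widen_ord le j)%:R.
have QE (x : V) j : (x *m Q) 0 j = x 0 (widen_ord le j).
  rewrite mxE (bigD1 (widen_ord le j)) //= mxE eqxx mulr1 big1 ?addr0 //.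
  by move=> i /negbTE ne; rewrite mxE ne mulr0.
have := limg_ker_dim (linfun (mulmxr Q)) antisymmetric_space.
have -> : (antisymmetric_space :&: lker (linfun (mulmxr Q)))%VS = 0%VS.
  apply/eqP; rewrite -subv0; apply/subvP => x; rewrite memv_cap memv0.
  case/andP => /antisymmetricP xa; rewrite memv_ker lfunE /= => /eqP x0.
  have low (k : 'I_m) : (k < n)%N -> x 0 k = 0.
    move=> kn; have := QE x (Ordinal kn); rewrite x0 mxE => ->.
    by congr (x 0 _); apply: val_inj.
  apply/eqP/rowP => k; rewrite mxE; case: (ltnP k n) => [/low //|nk].
  have := xa k; rewrite [x 0 (rev_ord k)]low ?addr0 //=.
  by have := ltn_ord k; lia.
rewrite dimv0 add0n => <-; apply: leq_trans (dimvS (subvf _)) _.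
by rewrite dimvf dim_matrix mul1r.
Qed.

End AntisymmetricVectors.

(** * The cyclohedron *)

Section Cyclohedron.
Variables (R : realType) (n : nat) (A : orientation n).
Hypotheses (n0 : (0 < n)%N) (symA : symmetric_orientation A).
Local Notation m := (2 * n)%N.
Local Notation N := (2 * n).+2.
Local Notation V := 'rV[R]_m.
Local Notation lam := (@label n A).
Local Notation M := (@M_point R n A).
Implicit Types (T D : {set {set 'I_N}}) (d : {set 'I_N}).

Let N3 : (2 < N)%N. Proof. by lia. Qed.

Let W T v := weight A T (lam v).

Lemma M_pointE T k : M T 0 k = (tri_coord (down_vertex A) (W T) (vertex A k.+1))%:~R.
Proof.
have kN : (k.+1 < N)%N by have := ltn_ord k; lia.
rewrite mxE /tri_coord /down_vertex /W vertexK //; case: (up A k.+1) => //=.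
have -> : Posz N - 1 = m.+1 by lia.
by rewrite intrB.
Qed.

Lemma M_point_int T k : M T 0 k \is a Num.int.
Proof. by rewrite M_pointE intr_int. Qed.

Lemma M_point_sum T k : cs_triangulation T ->
  M T 0 k + M T 0 (rev_ord k) = m.+1%:R.
Proof.
move=> csT; rewrite !mxE /=; have km := ltn_ord k.
have -> : (m - k.+1).+1 = (m.+1 - k.+1)%N by lia.
have [u1 um] : up A 1 = false /\ up A m = false by split; rewrite /up; lia.
have ends := weight_ends n0 symA csT.
have [k0|k0] := eqVneq (k : nat) 0%N.
  rewrite k0 u1 subn1 /= um -natrD; congr (_%:R); exact: ends.
have [kE|kE] := eqVneq k.+1 m.
  have -> : (m.+1 - k.+1 = 1)%N by lia.
  by rewrite kE u1 um -natrD addnC; congr (_%:R); exact: ends.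
have k1 : (1 < k.+1)%N by lia.
have k2 : (k.+1 < m)%N by lia.
rewrite (up_turn n0 symA k1 k2) (weight_half_turn n0 symA csT k1 k2).
by case: (up A k.+1) => /=; rewrite ?subrK // addrC subrK.
Qed.

(** The column is the indicator of the lower vertices, listed by label. *)
Lemma facet_column d : Defs.diagonal d -> exists (c : 'cV[R]_m) (b : R),
  forall T, triangulation T ->
    b <= ev c (M T) /\ (ev c (M T) == b) = (d \in T).
Proof.
move=> dd; have lab := label_labelling A.
have [u [v [dE ltuv]]] : exists u v, d = [set u; v]%SET /\ (lam u < lam v)%N.
  have [u [v [dE uv _]]] := diagonal_set2 dd.
  have : lam u != lam v by rewrite -(lab_neq lab) ltn_eqF.
  case: (ltngtP (lam u) (lam v)) => // h _; first by exists u, v.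
  by exists v, u; rewrite finset.setUC.
have duv : Defs.diagonal [set u; v]%SET by rewrite -dE.
have [c cP] := facet_functional N3 lab (fun T triT => weight_mid n0 triT (A := A)) ltuv duv.
exists (\col_i (lower (down_vertex A) u v (vertex A i.+1))%:R), c%:~R => T triT.
have [c1 c2] := cP T triT.
suff -> : ev (\col_i (lower (down_vertex A) u v (vertex A i.+1))%:R) (M T) =
    (facet_sum lam (down_vertex A) (fun T v => weight A T (lam v)) u v T)%:~R.
  by rewrite ler_int eqr_int c1 c2 dE.
rewrite /ev mxE /facet_sum rmorph_sum /=.
have m0 : (0 < m)%N by lia.
pose f (i : 'I_m) := vertex A i.+1.
have lf i : lam (f i) = i.+1 by rewrite vertexK //; have := ltn_ord i; lia.
(* Label [l] belongs to column [l - 1]; the default value is reached only for label [m + 1], which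
   is not inner. *)
pose g k : 'I_m := insubd (Ordinal m0) (lam k).-1.
have innerE k : inner lam k = (0 < lam k <= m)%N.
  apply/andP/idP => [[/existsP[x xk] /existsP[y ky]]|/andP[k0 km]].
    by have := label_lt A y; move: xk ky; clear; lia.
  split; apply/existsP; [exists (vertex A 0)|exists (vertex A m.+1)];
    by rewrite vertexK //; lia.
rewrite (reindex_onto f g) /=; last first.
  move=> k /andP[]; rewrite innerE => /andP[k0 km] _.
  by apply: (lab_inj lab); rewrite lf /g val_insubd; case: ifP; lia.
rewrite [RHS]big_mkcond; apply: eq_bigr => i _.
have -> : g (f i) == i.
  rewrite /g lf; apply/eqP/val_inj; rewrite val_insubd /=.
  by have -> : (i < m)%N by [].
rewrite andbT innerE lf ltn_ord /= [X in _ * X]mxE M_pointE.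
by case: (lower _ _ _ _); rewrite ?mulr1 ?mulr0.
Qed.

(** The inequalities of [d] and [turn d] are added. A symmetric [T] contains both diagonals or
    neither, so the two are tight together. *)
Lemma orbit_column : exists (g : {set 'I_N} -> 'cV[R]_m) (b : {set 'I_N} -> R),
  [/\ forall d, g (turn d) = g d, forall d, b (turn d) = b d &
    forall T d, cs_triangulation T -> Defs.diagonal d ->
      b d <= ev (g d) (M T) /\ (ev (g d) (M T) == b d) = (d \in T)].
Proof.
have /choice[cb cbP] : forall d, exists cb : 'cV[R]_m * R, Defs.diagonal d ->
    forall T, triangulation T ->
      cb.2 <= ev cb.1 (M T) /\ (ev cb.1 (M T) == cb.2) = (d \in T).
  move=> d; case dd: (Defs.diagonal d); last by exists (0, 0).
  by have [c [b H]] := facet_column dd; exists (c, b).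
exists (fun d => (cb d).1 + (cb (turn d)).1), (fun d => (cb d).2 + (cb (turn d)).2).
split=> [d|d|T d /andP[triT csT] dd]; try by rewrite turnK addrC.
have [h1 h2] := cbP d dd T triT.
have dtd : Defs.diagonal (turn d) by rewrite diagonal_turn.
have [h3 h4] := cbP (turn d) dtd T triT.
have -> c c' : ev (c + c') (M T) = ev c (M T) + ev c' (M T).
  by rewrite /ev mulmxDr mxE.
split; first by apply: lerD.
have : (ev (cb d).1 (M T) + ev (cb (turn d)).1 (M T) ==
       (cb d).2 + (cb (turn d)).2) =
   (ev (cb d).1 (M T) == (cb d).2) && (ev (cb (turn d)).1 (M T) == (cb (turn d)).2).
  apply/eqP/andP => [e|[/eqP-> /eqP->] //].
  by split; apply/eqP; lra.
by move=> ->; rewrite h2 h4 turn_centrally_symmetric // andbb.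
Qed.

Definition cs_vertices : set V := [set M T | T in [set T | cs_triangulation T]].

Local Notation S := (convex_hull cs_vertices).

Lemma vertex_basis (g : {set 'I_N} -> 'cV[R]_m) (b : {set 'I_N} -> R) T :
    (forall T d, cs_triangulation T -> Defs.diagonal d ->
      b d <= ev (g d) (M T) /\ (ev (g d) (M T) == b d) = (d \in T)) ->
    cs_triangulation T ->
  exists (d : 'I_n -> {set 'I_N}) (v : n.-tuple V),
    [/\ forall i, d i \in T,
        forall e, e \in T -> exists i, e = d i \/ e = turn (d i),
        free v /\ forall i, 0 < ev (g (d i)) v`_i,
        forall i : 'I_n, exists T', cs_triangulation T' /\ v`_i = M T' - M T &
        forall x, S x -> x - M T =
          \sum_(i < n) ((ev (g (d i)) x - b (d i)) / ev (g (d i)) v`_i) *: v`_i].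
Proof.
move=> gb csT; have [triT _] := andP csT.
have [/andP[/noncrossingP[dT _] _]] := triT.
have [r [ur sr rT orb anti]] := orbit_representatives n0 csT.
pose d (i : 'I_n) := nth (finset.set0 : {set 'I_N}) r i.
have dr i : d i \in r by rewrite mem_nth // sr.
have flips i : exists T', [/\ cs_triangulation T', d i \notin T' &
    forall e, e \in T -> e != d i -> e != turn (d i) -> e \in T'].
  exact: (cs_flip n0 csT (rT _ (dr i))).
have [F FP] := choice flips.
pose v : n.-tuple V := [tuple M (F i) - M T | i < n].
have vE (i : 'I_n) : v`_i = M (F i) - M T.
  by rewrite nth_mktuple.
have tight i : ev (g (d i)) (M T) = b (d i).
  by apply/eqP; have [_ ->] := gb T (d i) csT (dT _ (rT _ (dr i))); apply: rT.
(* [F j] keeps every orbit but that of [d j], so [M (F j)] and [M T] both lie on the facet of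
   [d i]. *)
have offd i j : i != j -> ev (g (d i)) v`_j = 0.
  move=> ij; have [csF _ keep] := FP j; rewrite vE evB tight; apply/eqP.
  rewrite subr_eq0; have [_ ->] := gb _ (d i) csF (dT _ (rT _ (dr i))).
  apply: keep; first exact: rT.
    by rewrite nth_uniq ?sr.
  apply: contraNneq ij => e; have := anti _ _ (dr j) (dr i) e.
  by move/eqP; rewrite nth_uniq ?sr.
have posd i : 0 < ev (g (d i)) v`_i.
  have [csF nF _] := FP i; rewrite vE evB tight subr_gt0 lt_neqAle eq_sym.
  by have [-> ->] := gb _ (d i) csF (dT _ (rT _ (dr i))); rewrite nF.
have evs (k : 'I_n -> R) i :
    ev (g (d i)) (\sum_(j < n) k j *: v`_j) = k i * ev (g (d i)) v`_i.
  rewrite ev_sum (bigD1 i) //= evZ big1 ?addr0 // => j ji.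
  by rewrite evZ offd ?mulr0 // eq_sym.
have freev : free v.
  apply/freeP => k k0 i; have := evs k i; rewrite k0.
  rewrite /ev mul0mx mxE => /esym/eqP; rewrite mulf_eq0 => /orP[/eqP //|].
  by rewrite gt_eqF // posd.
have anti_diff T' : cs_triangulation T' -> M T' - M T \in antisymmetric_space R n.
  move=> csT'; apply/antisymmetricP => k.
  rewrite !mxE addrACA -opprD.
  have := M_point_sum k csT; have := M_point_sum k csT'; rewrite !mxE => -> ->.
  by rewrite subrr.
(* The flip directions are [n] independent vectors in a space of dimension at most [n], so they span
   it and give coordinates to every point of the hull. *)
have spanE : <<v>>%VS = antisymmetric_space R n.
  apply/eqP; rewrite eqEdim; apply/andP; split.
    apply/span_subvP => x /(nthP 0)[i]; rewrite size_tuple => ilt <-.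
    by rewrite (vE (Ordinal ilt)); apply: anti_diff; have [] := FP (Ordinal ilt).
  by have := freev; rewrite /free size_tuple => /eqP ->; apply: dim_antisymmetric.
exists d, v; split=> //.
- by move=> i; apply: rT.
- have idx e : e \in r -> exists i, e = d i.
    move=> er; have ilt : (index e r < n)%N.
      by apply: leq_trans (eq_leq sr); rewrite index_mem.
    by exists (Ordinal ilt); rewrite /d nth_index.
  move=> e /orb[/idx[i ->]|/idx[i ei]]; exists i; [by left|right].
  by rewrite -ei turnK.
- move=> i; exists (F i); rewrite vE; split=> //; by have [] := FP i.
- move=> x Sx; have : x - M T \in <<v>>%VS.
    rewrite spanE; apply: (hull_sub_vspace (X := cs_vertices)) Sx => y [T' csT' <-].
    exact: anti_diff.
  move=> /coord_span xE; rewrite [LHS]xE; apply: eq_bigr => i _.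
  have := evs (fun i => coord v i (x - M T)) i; rewrite -xE evB tight => ->.
  by rewrite mulfK // gt_eqF // posd.
Qed.

Lemma cs_triangulation_exists : exists T, cs_triangulation T.
Proof.
have nc0 : noncrossing_diagonals (finset.set0 : {set {set 'I_N}}).
  by apply/noncrossingP; split=> [d|d e]; rewrite inE.
have cs0 : centrally_symmetric (finset.set0 : {set {set 'I_N}}).
  by apply: centrally_symmetricP => d; rewrite inE.
by have [T [csT _]] := cs_extend n0 nc0 cs0; exists T.
Qed.

Lemma cs_vertices_polytope : polytope S.
Proof.
exists [seq M T | T <- enum [pred T : {set {set 'I_N}} | cs_triangulation T]].
congr convex_hull; apply/seteqP; split=> x /=.
  by case=> T csT <-; apply: map_f; rewrite mem_enum.
by case/mapP => T; rewrite mem_enum => csT ->; exists T.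
Qed.

Lemma cs_vertices_dim : has_dim S n.
Proof.
have [g [b [_ _ gb]]] := orbit_column.
have [T csT] := cs_triangulation_exists.
have [d [v [_ _ [freev _] vM xE]]] := vertex_basis gb csT.
exists (M T), <<v>>%VS; split.
- by apply: sub_hull; exists T.
- move=> x /xE ->; apply: memv_suml => i _; apply/memvZ/memv_span.
  by rewrite mem_nth // size_tuple.
- move=> U H; apply/span_subvP => x /(nthP 0)[i]; rewrite size_tuple => ilt <-.
  have [T' [csT' ->]] := vM (Ordinal ilt); apply: H.
  by apply: sub_hull; exists T'.
- by have := freev; rewrite /free size_tuple => /eqP.
Qed.

Lemma cs_vertices_faces : face_lattice_iso S (@cyclohedron_le n).
Proof.
have [g [b [gturn bturn gb]]] := orbit_column.
have geS x d : S x -> Defs.diagonal d -> b d <= ev (g d) x.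
  move=> Sx dd; apply: hull_ev_ge Sx => _ [T csT <-].
  by have [] := gb T d csT dd.
have inS T : cs_triangulation T -> S (M T).
  by move=> csT; apply: sub_hull; exists T.
pose phi (o : cyclohedron_face n) : set V := if o is Some D
  then S `&` [set x | forall d, d \in val D -> ev (g d) x = b d] else set0.
exists phi; split.
- case=> [[D /= /andP[/noncrossingP[dD _] _]]|]; last first.
    (* The inequality [0 <= 1] is valid and never tight. *)
    exists 0, 1; split=> [x _|]; first by rewrite mulmx0 mxE ler01.
    apply/seteqP; split=> // x [_] /=; rewrite mulmx0 mxE => /eqP.
    by rewrite eq_sym oner_eq0.
  (* Facets are minima while [face] asks for maxima, hence the sign. A sum of valid inequalities is
     tight exactly where each of them is. *)
  exists (- \sum_(d in D) g d), (- \sum_(d in D) b d).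
  have evE x : (x *m - \sum_(d in D) g d) 0 0 = - \sum_(d in D) ev (g d) x.
    by rewrite mulmxN mxE mulmx_sumr summxE.
  split=> [x Sx|].
    by rewrite evE lerN2; apply: ler_sum => d dD'; apply: geS => //; apply: dD.
  apply/seteqP; split=> x [Sx] /= H; split=> //=.
    by rewrite evE; congr (- _); apply: eq_bigr.
  move: H; rewrite evE => /oppr_inj/eqP; rewrite -subr_eq0 -sumrB => /eqP H0.
  move=> d dD'; apply/eqP; rewrite -subr_eq0; apply/eqP.
  by apply: (psumr_eq0P _ H0) dD' => e eD; rewrite subr_ge0 geS //; apply: dD.
- move=> F [c [B [H FE]]].
  have [[x0 Fx0]|noF] := pselect (exists x, F x); last first.
    exists None; apply/seteqP; split=> // x Fx; case: noF; by exists x.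
  have [T0 csT0] := cs_triangulation_exists.
  have [T csT maxT] := Order.TotalTheory.arg_maxP (fun T => ev c (M T)) csT0.
  have cT : ev c (M T) = B.
    apply/eqP; rewrite eq_le; apply/andP; split; first exact: (H _ (inS _ csT)).
    move: Fx0; rewrite FE => -[Sx0 /= <-].
    by apply: hull_ev_le Sx0 => _ [T' csT' <-]; apply: maxT.
  have [triT _] := andP csT; have [/andP[ncT _]] := triT.
  have [dT nT] := noncrossingP _ ncT.
  have [d [v [dinT Td [_ vpos] vM xE]]] := vertex_basis gb csT.
  have sle (i : 'I_n) : ev c v`_i <= 0.
    by have [T' [csT' ->]] := vM i; rewrite evB subr_le0; apply: maxT.
  pose D : {set {set 'I_N}} := [set e in T | [exists i : 'I_n, (ev c v`_i < 0) &&
    ((e == d i) || (e == turn (d i)))]]%SET.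
  have DP e : e \in D -> e \in T /\
      exists2 i : 'I_n, ev c v`_i < 0 & e = d i \/ e = turn (d i).
    rewrite inE => /andP[-> /existsP[i /andP[si ei]]]; split=> //.
    by exists i => //; case/orP: ei => /eqP; auto.
  have dinD (i : 'I_n) : ev c v`_i < 0 -> d i \in D.
    by move=> si; rewrite inE dinT; apply/existsP; exists i; rewrite si eqxx.
  have DPf : noncrossing_diagonals D && centrally_symmetric D.
    apply/andP; split.
      apply/noncrossingP; split=> [e /DP[/dT]//|e f /DP[? _] /DP[? _]].
      exact: nT.
    apply: centrally_symmetricP => e; rewrite !inE.
    have [_ csT'] := andP csT; rewrite turn_centrally_symmetric //.
    case/andP => -> /existsP[i /andP[si ei]]; apply/existsP; exists i.
    rewrite si /=; case/orP: ei => /eqP->; rewrite ?turnK eqxx ?orbT //.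
  pose l x (i : 'I_n) := (ev (g (d i)) x - b (d i)) / ev (g (d i)) v`_i.
  (* On the hull the functional is its maximum plus nonpositive terms. It is maximal exactly where
     the coordinates of negative slope vanish, that is, on the facets of [D]. *)
  have cE x : S x -> ev c x = B + \sum_(i < n) l x i * ev c v`_i.
    move=> Sx; rewrite -cT -[x in LHS](subrK (M T)) evD addrC; congr (_ + _).
    by rewrite (xE x Sx) ev_sum; apply: eq_bigr => i _; rewrite evZ.
  have lge x i : S x -> 0 <= l x i.
    move=> Sx; rewrite divr_ge0 ?(ltW (vpos i)) // subr_ge0 geS //.
    exact: dT.
  exists (Some (exist _ D DPf)); rewrite FE; apply/seteqP.
  split=> x [Sx] /= Hx; split=> //=.
    rewrite -[LHS]/(ev c x) cE // big1 ?addr0 // => i _.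
    have [s0|s0] := ltP (ev c v`_i) 0.
      by rewrite /l Hx ?dinD // subrr mul0r mul0r.
    have -> : ev c v`_i = 0 by apply/eqP; rewrite eq_le sle s0.
    by rewrite mulr0.
  move: Hx; rewrite -[X in X = _]/(ev c x) cE // => /eqP.
  rewrite -subr_eq0 addrAC subrr add0r -oppr_eq0 -sumrN => /eqP H0.
  have lz (i : 'I_n) : ev c v`_i < 0 -> ev (g (d i)) x = b (d i).
    have nn (j : 'I_n) : true -> 0 <= - (l x j * ev c v`_j).
      by move=> _; rewrite oppr_ge0 mulr_ge0_le0 ?lge.
    move=> si; have /(_ i isT)/eqP := psumr_eq0P nn H0.
    rewrite oppr_eq0 mulf_eq0 (lt_eqF si) orbF mulf_eq0 invr_eq0.
    by rewrite (gt_eqF (vpos i)) orbF subr_eq0 => /eqP.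
  move=> e /DP[_ [i /lz ei [->|->]]] //.
  by rewrite gturn bturn.
- have phiT D pf T : cs_triangulation T ->
      phi (Some (exist _ D pf)) (M T) <-> D \subset T.
    move=> csT; have /andP[/noncrossingP[dD _] _] := pf.
    split=> [[_ /= H]|sub].
      apply/fintype.subsetP => e eD; have [_ <-] := gb T e csT (dD _ eD).
      by rewrite H.
    split; first exact: inS.
    move=> e eD; apply/eqP; have [_ ->] := gb T e csT (dD _ eD).
    exact: (fintype.subsetP sub).
  move=> [[D pD]|] [[E pE]|] /=.
  all: try by split=> // _ x [].
  + split=> [ED x [Sx H]|sub].
      by split=> // e eE; apply: H; apply: (fintype.subsetP ED).
    have [/andP[ncD csD] /andP[/noncrossingP[dE _] _]] := (pD, pE).
    have [T [csT DT]] := cs_extend n0 ncD csD.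
    (* If [e] is in [E] but not in [D], flipping its orbit in a triangulation that contains [D]
       yields a vertex of [phi D] outside [phi E]. *)
    apply/fintype.subsetP => e eE; apply/negPn/negP => eD.
    have sub' T' : cs_triangulation T' -> D \subset T' -> e \in T'.
      move=> csT' /(phiT D pD T' csT')/sub/(phiT E pE T' csT').
      by move=> /fintype.subsetP; apply.
    have [T' [csT' eT' keep]] := cs_flip n0 csT (sub' T csT DT).
    move/negP: eT'; apply; apply: sub' => //.
    apply/fintype.subsetP => f fD; apply: keep.
    * exact: (fintype.subsetP DT).
    * by apply: contraNneq eD => <-.
    * by apply: contraNneq eD => fe; rewrite -(turn_centrally_symmetric _ csD) -fe.
  (* Every [D] extends to a symmetric triangulation, so its face has a vertex and is not empty. *)
  + split=> // sub; have /andP[ncD csD] := pD.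
    have [T [csT DT]] := cs_extend n0 ncD csD.
    by have := sub _ ((phiT D pD T csT).2 DT).
Qed.

End Cyclohedron.

Theorem theorem1p5 (R : realType) (n : nat) (A : orientation n)
    (hn : (1 <= n)%N) (hA : symmetric_orientation A) :
  realizes_cyclohedron n
    (convex_hull [set M_point R A T | T in [set T | cs_triangulation T]]) /\
  (forall T : {set {set 'I_(2 * n).+2}}, cs_triangulation T ->
     forall k : 'I_(2 * n), M_point R A T 0 k \is a Num.int).
Proof.
split; last by move=> T _ k; apply: M_point_int.
split; first exact: cs_vertices_polytope.
- exact: cs_vertices_dim.
- exact: cs_vertices_faces.
Qed.
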